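(* Let $(A,\tau_A)$ be a unital locally $C^{\ast}$-algebra, and let $I$ and $J$ be closed $^{\ast}$-ideals in $A$, each equipped with the topology induced by $\tau_A$ (i.e. $\tau_I=\tau_A|_I$, $\tau_J=\tau_A|_J$). Then $$(I+J)^{+}=I^{+}+J^{+},$$ where $I^{+}+J^{+}=\{a+b: a\in I^{+},\ b\in J^{+}\}$.
   Context: A locally $C^{\ast}$-algebra is a complete Hausdorff topological $^{\ast}$-algebra over $\mathbb{C}$ whose topology is generated by a separating (saturated) family of $C^{\ast}$-seminorms $\|\cdot\|_\alpha$ (seminorms with $\|a^*a\|_\alpha=\|a\|_\alpha^2$); equivalently, it is topologically $^{\ast}$-isomorphic to a projective limit of a projective family of $C^{\ast}$-algebras. A $^{\ast}$-ideal is a two-sided ideal closed under the involution. An element $a$ of a unital locally $C^{\ast}$-algebra $A$ is positive if $a=a^*$ and its spectrum $\{z\in\mathbb{C}: z e_A-a \text{ not invertible in } A\}$ is contained in $[0,\infty)$; equivalently $a=b^*b$ for some $b\in A$. $A^{+}$ denotes the set of positive elements of $A$, and for a subset $S\subseteq A$ (such as $I$, $J$ or $I+J$), $S^{+}$ denotes the set of elements of $S$ that are positive, i.e. $S^{+}=S\cap A^{+}$. *)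

(* Defs.v *)
From Stdlib Require List.
From mathcomp Require Import all_boot all_order all_algebra.
From mathcomp Require Export complex reals.
Set Implicit Arguments. Unset Strict Implicit. Unset Printing Implicit Defensive.
Import Order.TTheory GRing.Theory Num.Theory.
Local Open Scope ring_scope.

Section LocallyCstar.
Variables (R : realType) (A : algType R[i]) (star : A -> A).
Variables (Lam : Type) (p : Lam -> A -> R).

Definition is_involution : Prop :=
  [/\ forall a, star (star a) = a,
      forall a b, star (a + b) = star a + star b,
      forall (c : R[i]) a, star (c *: a) = c^* *: star a
    & forall a b, star (a * b) = star b * star a].

Definition is_Cstar_seminorm (q : A -> R) : Prop :=
  [/\ forall a, 0 <= q a,
      forall a b, q (a + b) <= q a + q b,
      forall (c : R[i]) a, q (c *: a) = ComplexField.Normc.normc c * q a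
    & forall a, q (star a * a) = q a ^+ 2].

(* basic neighbourhood of x for the topology generated by the family p:
   finitely many seminorms, radius e *)
Definition pball (l : seq Lam) (e : R) (x y : A) : Prop :=
  forall al, List.In al l -> p al (y - x) < e.

Definition is_proper_filter (F : (A -> Prop) -> Prop) : Prop :=
  [/\ F (fun _ => True),
      forall P Q, F P -> F Q -> F (fun x => P x /\ Q x),
      forall P Q : A -> Prop, (forall x, P x -> Q x) -> F P -> F Q
    & ~ F (fun _ => False)].

Definition filter_cauchy (F : (A -> Prop) -> Prop) : Prop :=
  forall al (e : R), 0 < e ->
    exists2 B, F B & forall x y, B x -> B y -> p al (x - y) < e.

Definition filter_converges (F : (A -> Prop) -> Prop) (x : A) : Prop :=
  forall l (e : R), 0 < e -> F (pball l e x).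

Definition tclosed (S : A -> Prop) : Prop :=
  forall x, (forall l (e : R), 0 < e -> exists y, S y /\ pball l e x y) -> S x.

(* (A, tau_A) is a unital locally C*-algebra whose topology tau_A is
   generated by the family of C*-seminorms p *)
Definition locally_Cstar_algebra : Prop :=
  is_involution /\
  (forall al, is_Cstar_seminorm (p al)) /\
  (forall a, (forall al, p al a = 0) -> a = 0) /\
  (forall al be, exists ga, forall a, p al a <= p ga a /\ p be a <= p ga a) /\
  (forall al, exists be (C : R), forall a b, p al (a * b) <= C * p be a * p be b) /\
  (forall al, exists be (C : R), forall a, p al (star a) <= C * p be a) /\
  (forall F, is_proper_filter F -> filter_cauchy F -> exists x, filter_converges F x).

Definition closed_star_ideal (I : A -> Prop) : Prop :=
  I 0 /\
  (forall a b, I a -> I b -> I (a + b)) /\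
  (forall (c : R[i]) a, I a -> I (c *: a)) /\
  (forall a x, I a -> I (x * a) /\ I (a * x)) /\
  (forall a, I a -> I (star a)) /\
  tclosed I.

Definition invertible (a : A) : Prop := exists b, a * b = 1 /\ b * a = 1.

(* positive: self-adjoint with spectrum in [0, oo).  In R[i] (a
   numClosedFieldType) the order satisfies 0 <= z iff z is a nonnegative real. *)
Definition positive (a : A) : Prop :=
  a = star a /\ forall z : R[i], ~ invertible (z *: 1 - a) -> 0 <= z.

End LocallyCstar.

(* Main.v *)
Require Import Defs.
From mathcomp Require Import all_boot all_order all_algebra complex reals.
From mathcomp Require Import boolp ring lra.
Import Order.TTheory GRing.Theory Num.Theory.
Local Open Scope ring_scope.

(* Let x = i + j be positive, with i in I and j in J self-adjoint. Then
   x <= s^2 := |i| + |j|, and |i|, |j| lie in I, J since these are closed. With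
   c = x^(1/2), r = |i|^(1/2), r' = |j|^(1/2), the elements r (e + s)^-1 c and
   r' (e + s)^-1 c are Cauchy as e -> 0, at a rate |e - d| which is the same for
   all seminorms; their limits w, w' satisfy w^* w in I, w'^* w' in J and
   w^* w + w'^* w' = x. No closedness of I + J is needed.

   Neither submultiplicativity nor q(a^* ) = q(a) is assumed for a C*-seminorm q.
   Polarization gives both up to constants, and the power trick
   q(h^(2^n)) = q(h)^(2^n) removes the constants. Positivity is handled through
   the inequality q(t - a) <= t, which makes sense without completeness of q;
   the global spectral condition is reached by building inverses and square
   roots as limits of approximations that are adapted to one seminorm each. *)

(** * Reflexive identities in an algebra *)

Inductive alg_expr (C : Type) : Type :=
  | AVar of nat
  | AZero
  | AOne
  | AAdd of alg_expr C & alg_expr C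
  | AOpp of alg_expr C
  | AMul of alg_expr C & alg_expr C
  | AScale of C & alg_expr C.
Arguments AVar {C}.
Arguments AZero {C}.
Arguments AOne {C}.
Arguments AAdd {C}.
Arguments AOpp {C}.
Arguments AMul {C}.
Arguments AScale {C}.

(** Comparison, sorting and concatenation are redefined so that [cbv] with an explicit list of names
    evaluates words completely while the coefficients in [R[i]] stay folded. *)
Fixpoint nat_eqb (m n : nat) : bool :=
  match m, n with
  | 0, 0 => true
  | S m', S n' => nat_eqb m' n'
  | _, _ => false
  end%N.

Fixpoint nat_leb (m n : nat) : bool :=
  match m, n with
  | 0, _ => true
  | S m', S n' => nat_leb m' n'
  | _, _ => false
  end%N.

Fixpoint word_eqb (u v : seq nat) : bool :=
  match u, v with
  | [::], [::] => true
  | m :: u', n :: v' => if nat_eqb m n then word_eqb u' v' else false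
  | _, _ => false
  end.

Fixpoint word_insert (m : nat) (u : seq nat) : seq nat :=
  match u with
  | [::] => [:: m]
  | n :: u' => if nat_leb m n then m :: u else n :: word_insert m u'
  end.

Fixpoint word_cat (u v : seq nat) : seq nat :=
  if u is m :: u' then m :: word_cat u' v else v.

Fixpoint word_merge (u v : seq nat) : seq nat :=
  if u is m :: u' then word_insert m (word_merge u' v) else v.

Section AlgNorm.
Variables (R : realType) (A : algType R[i]).
Local Notation C := R[i].

Fixpoint env_nth (env : seq A) (n : nat) : A :=
  match env, n with
  | x :: _, 0%N => x
  | _ :: env', S n' => env_nth env' n'
  | [::], _ => 0
  end.

Fixpoint alg_eval (env : seq A) (e : alg_expr C) : A :=
  match e with
  | AVar n => env_nth env n
  | AZero => 0
  | AOne => 1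
  | AAdd e1 e2 => alg_eval env e1 + alg_eval env e2
  | AOpp e1 => - alg_eval env e1
  | AMul e1 e2 => alg_eval env e1 * alg_eval env e2
  | AScale c e1 => c *: alg_eval env e1
  end.

Fixpoint word_eval (env : seq A) (u : seq nat) : A :=
  if u is m :: u' then env_nth env m * word_eval env u' else 1.

Fixpoint nf_eval (env : seq A) (P : seq (C * seq nat)) : A :=
  if P is (c, u) :: P' then c *: word_eval env u + nf_eval env P' else 0.

Fixpoint nf_insert (c : C) (u : seq nat) (P : seq (C * seq nat)) :=
  match P with
  | [::] => [:: (c, u)]
  | (d, v) :: P' =>
      if word_eqb u v then (c + d, v) :: P' else (d, v) :: nf_insert c u P'
  end.

Fixpoint nf_add (P Q : seq (C * seq nat)) :=
  if P is (c, u) :: P' then nf_insert c u (nf_add P' Q) else Q.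

Fixpoint nf_scale (c : C) (P : seq (C * seq nat)) :=
  if P is (d, u) :: P' then (c * d, u) :: nf_scale c P' else [::].

(** The parameter [m] multiplies monomials: [word_cat] in the noncommutative case, the sorting
    [word_merge] when the atoms commute. *)
Fixpoint nf_mulw (m : seq nat -> seq nat -> seq nat) (c : C) (u : seq nat)
    (P : seq (C * seq nat)) :=
  if P is (d, v) :: P' then nf_insert (c * d) (m u v) (nf_mulw m c u P')
  else [::].

Fixpoint nf_mul (m : seq nat -> seq nat -> seq nat) (P Q : seq (C * seq nat)) :=
  if P is (c, u) :: P' then nf_add (nf_mulw m c u Q) (nf_mul m P' Q) else [::].

Fixpoint alg_nf (m : seq nat -> seq nat -> seq nat) (e : alg_expr C) :=
  match e with
  | AVar n => [:: (1, [:: n])]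
  | AZero => [::]
  | AOne => [:: (1, [::])]
  | AAdd e1 e2 => nf_add (alg_nf m e1) (alg_nf m e2)
  | AOpp e1 => nf_scale (- 1) (alg_nf m e1)
  | AMul e1 e2 => nf_mul m (alg_nf m e1) (alg_nf m e2)
  | AScale c e1 => nf_scale c (alg_nf m e1)
  end.

(** Equality of scalars is not decided by computation, so a conjunction of equations in [R[i]] is
    left for [ring] or [field]. *)
Fixpoint nf_zero (P : seq (C * seq nat)) : Prop :=
  if P is (c, _) :: P' then c = 0 /\ nf_zero P' else True.

Lemma nat_eqbP m n : nat_eqb m n -> m = n.
Proof. by elim: m n => [|m IH] [|n] //= /IH ->. Qed.

Lemma word_eqbP u v : word_eqb u v -> u = v.
Proof.
elim: u v => [|m u IH] [|n v] //=.
by case: ifP => // /nat_eqbP -> /IH ->.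
Qed.

Section Eval.
Variables (env : seq A) (m : seq nat -> seq nat -> seq nat).
Hypothesis mE :
  forall u v, word_eval env (m u v) = word_eval env u * word_eval env v.

Lemma nf_insertE c u P :
  nf_eval env (nf_insert c u P) = c *: word_eval env u + nf_eval env P.
Proof.
elim: P => [|[d v] P IH] //=; case: ifP => [/word_eqbP ->|_] /=.
  by rewrite scalerDl addrA.
by rewrite IH addrCA.
Qed.

Lemma nf_addE P Q : nf_eval env (nf_add P Q) = nf_eval env P + nf_eval env Q.
Proof.
by elim: P => [|[c u] P IH] /=; rewrite ?add0r // nf_insertE IH addrA.
Qed.

Lemma nf_scaleE c P : nf_eval env (nf_scale c P) = c *: nf_eval env P.
Proof.
by elim: P => [|[d u] P IH] /=; rewrite ?scaler0 // IH scalerDr scalerA.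
Qed.

Lemma nf_mulwE c u P :
  nf_eval env (nf_mulw m c u P) = c *: word_eval env u * nf_eval env P.
Proof.
elim: P => [|[d v] P IH] /=; first by rewrite mulr0.
rewrite nf_insertE IH mE mulrDr; congr (_ + _).
by rewrite -scalerAl -scalerAr scalerA.
Qed.

Lemma nf_mulE P Q : nf_eval env (nf_mul m P Q) = nf_eval env P * nf_eval env Q.
Proof.
elim: P => [|[c u] P IH] /=; first by rewrite mul0r.
by rewrite nf_addE nf_mulwE IH mulrDl.
Qed.

Lemma alg_nfE e : nf_eval env (alg_nf m e) = alg_eval env e.
Proof.
elim: e => [n||| e1 IH1 e2 IH2|e IH|e1 IH1 e2 IH2|c e IH] //=.
- by rewrite addr0 scale1r mulr1.
- by rewrite addr0 scale1r.
- by rewrite nf_addE IH1 IH2.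
- by rewrite nf_scaleE IH scaleN1r.
- by rewrite nf_mulE IH1 IH2.
- by rewrite nf_scaleE IH.
Qed.

Lemma nf_zeroE P : nf_zero P -> nf_eval env P = 0.
Proof. by elim: P => [|[c u] P IH] //= [-> /IH ->]; rewrite scale0r add0r. Qed.

Lemma alg_nf_eq e1 e2 :
  nf_zero (alg_nf m (AAdd e1 (AOpp e2))) -> alg_eval env e1 = alg_eval env e2.
Proof. by move=> /nf_zeroE; rewrite alg_nfE /= => /subr0_eq. Qed.

End Eval.

Lemma word_catE env u v :
  word_eval env (word_cat u v) = word_eval env u * word_eval env v.
Proof. by elim: u => [|n u IH] /=; rewrite ?mul1r // IH mulrA. Qed.

Definition nc_alg_eq env := alg_nf_eq env word_cat (word_catE env).

Fixpoint all_comm_with (x : A) (env : seq A) : Prop :=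
  if env is y :: env' then y * x = x * y /\ all_comm_with x env' else True.

Fixpoint pairwise_comm (env : seq A) : Prop :=
  if env is x :: env' then all_comm_with x env' /\ pairwise_comm env' else True.

Lemma all_comm_withP x env n :
  all_comm_with x env -> env_nth env n * x = x * env_nth env n.
Proof.
elim: env n => [|y env IH] [|n] /=; rewrite ?mulr0 ?mul0r // => -[// _].
exact: IH.
Qed.

Lemma pairwise_commP env m n :
  pairwise_comm env ->
  env_nth env m * env_nth env n = env_nth env n * env_nth env m.
Proof.
elim: env m n => [|y env IH] [|m] [|n] //= [hy henv].
- by rewrite all_comm_withP.
- by rewrite all_comm_withP.
- exact: IH.
Qed.

Lemma word_mergeE env u v : pairwise_comm env ->
  word_eval env (word_merge u v) = word_eval env u * word_eval env v.
Proof.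
move=> henv.
have insE n w : word_eval env (word_insert n w) = env_nth env n * word_eval env w.
  elim: w => [|k w IH] //=; case: ifP => //= _.
  by rewrite IH !mulrA (pairwise_commP _ k).
by elim: u => [|n u IH] /=; rewrite ?mul1r // insE IH mulrA.
Qed.

Definition comm_alg_eq env (henv : pairwise_comm env) :=
  alg_nf_eq env word_merge (fun u v => word_mergeE env u v henv).

End AlgNorm.

(** * Reification of goals into [alg_expr] *)

Ltac alg_mem x l :=
  lazymatch l with
  | nil => constr:(false)
  | cons x _ => constr:(true)
  | cons _ ?l' => alg_mem x l'
  end.

(** Applications of [star] and powers other than literal squares and cubes count as atoms; adjoints
    are therefore expanded, and powers unfolded or generalized, before an identity is reified. *)
Ltac alg_atoms t l :=
  lazymatch t with
  | @GRing.add _ ?a ?b => let l' := alg_atoms b l in alg_atoms a l'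
  | @GRing.opp _ ?a => alg_atoms a l
  | @GRing.mul _ ?a ?b => let l' := alg_atoms b l in alg_atoms a l'
  | @GRing.scale _ _ _ ?a => alg_atoms a l
  | @GRing.zero _ => l
  | @GRing.one _ => l
  | @GRing.exp _ ?a 2%N => alg_atoms a l
  | @GRing.exp _ ?a 3%N => alg_atoms a l
  | _ => lazymatch alg_mem t l with
         | true => l
         | false => constr:(cons t l)
         end
  end.

Ltac alg_index x l :=
  lazymatch l with
  | cons x _ => constr:(O)
  | cons _ ?l' => let n := alg_index x l' in constr:(S n)
  end.

Ltac alg_reify C t l :=
  lazymatch t with
  | @GRing.add _ ?a ?b =>
      let a' := alg_reify C a l in let b' := alg_reify C b l in
      constr:(@AAdd C a' b')
  | @GRing.opp _ ?a => let a' := alg_reify C a l in constr:(@AOpp C a')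
  | @GRing.mul _ ?a ?b =>
      let a' := alg_reify C a l in let b' := alg_reify C b l in
      constr:(@AMul C a' b')
  | @GRing.scale _ _ ?c ?a =>
      let a' := alg_reify C a l in constr:(@AScale C c a')
  | @GRing.zero _ => constr:(@AZero C)
  | @GRing.one _ => constr:(@AOne C)
  | @GRing.exp _ ?a 2%N =>
      let a' := alg_reify C a l in constr:(@AMul C a' a')
  | @GRing.exp _ ?a 3%N =>
      let a' := alg_reify C a l in constr:(@AMul C a' (@AMul C a' a'))
  | _ => let n := alg_index t l in constr:(@AVar C n)
  end.

Ltac alg_coefs tac :=
  cbv [alg_nf nf_add nf_insert nf_mul nf_mulw nf_scale nf_zero word_eqb
       nat_eqb nat_leb word_insert word_cat word_merge];
  repeat split; tac.

(* [nc_alg] proves an identity in an arbitrary algebra over [R[i]], [comm_alg]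
   one in which the atoms commute pairwise, as recorded by the hypotheses. *)
Ltac alg_apply lem :=
  lazymatch goal with
  | R : Real.type, A : GRing.Algebra.type _ |- @eq _ ?s ?t =>
      let K := constr:(complex (Real.sort R)) in
      let E := constr:(@nil (GRing.Algebra.sort A)) in
      let l0 := alg_atoms s E in
      let l := alg_atoms t l0 in
      let s' := alg_reify K s l in
      let t' := alg_reify K t l in
      lem R A l s' t'
  end.

Ltac nc_alg_with tac :=
  alg_apply ltac:(fun R A l s t => apply: (@nc_alg_eq R A l s t));
  alg_coefs tac.

Ltac comm_alg_with tac :=
  alg_apply ltac:(fun R A l s t => apply: (@comm_alg_eq R A l _ s t));
  [ cbv [pairwise_comm all_comm_with]; repeat split;
    try (assumption || (symmetry; assumption))
  | alg_coefs tac ].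

Ltac nc_alg := nc_alg_with ltac:(ring).
Ltac comm_alg := comm_alg_with ltac:(ring).

(** * C*-seminorms *)

(** Most approximation arguments below end here. If x > y, a small [e] makes [K * e] at most half of
    the gap; the restriction [e <= 1] lets quadratic errors be absorbed into [K]. *)
Lemma le_eps_lin (R : realType) (x y K : R) :
  (forall e, 0 < e -> e <= 1 -> x <= y + K * e) -> x <= y.
Proof.
move=> h; rewrite leNgt; apply/negP => yx.
have K1 : 0 < `|K| + 1 by rewrite ltr_wpDl.
set e := Num.min 1 ((x - y) / (2 * (`|K| + 1))).
have e0 : 0 < e by rewrite lt_min ltr01 /= divr_gt0 ?mulr_gt0 ?subr_gt0.
have e1 : e <= 1 by rewrite ge_min lexx.
have : K * e <= (x - y) / 2.
  apply: (@le_trans _ _ ((`|K| + 1) * e)).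
    by rewrite ler_pM2r // (le_trans (ler_norm K)) // lerDl.
  rewrite mulrC -ler_pdivlMr // -mulrA -invfM ge_min lexx orbT //.
by have := h _ e0 e1; lra.
Qed.

(** For x > y > 0, x / y = 1 + d with d > 0, and Bernoulli's inequality makes (x / y)^n exceed every
    [K]. The exponents are powers of 2 because these are what the C*-identity yields by
    iteration. *)
Lemma le_pow2_const (R : realType) (x y K : R) : 0 <= x -> 0 <= y ->
  (forall n, x ^+ (2 ^ n) <= K * y ^+ (2 ^ n)) -> x <= y.
Proof.
move=> x0 y0 h; rewrite leNgt; apply/negP => yx.
have K0 : 0 <= K.
  by rewrite leNgt; apply/negP => Kn; have := h 0%N; rewrite expn0 !expr1; nra.
have [yz|ynz] := eqVneq y 0.
  have := h 0%N; rewrite expn0 !expr1 yz mulr0; lra.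
have yp : 0 < y by rewrite lt_def ynz y0.
set d := x / y - 1.
have d0 : 0 < d by rewrite subr_gt0 ltr_pdivlMr ?mul1r.
have bern n : 1 + n%:R * d <= (x / y) ^+ n.
  elim: n => [|n IH]; first by rewrite mul0r addr0 expr0.
  rewrite exprS -natr1; have -> : x / y = 1 + d by rewrite /d; lra.
  rewrite (_ : x / y = 1 + d) in IH; last by rewrite /d; lra.
  have nd : 0 <= n%:R * d by rewrite mulr_ge0 ?ler0n // ltW.
  by set p := (1 + d) ^+ n in IH *; nra.
have [N hN] : exists N : nat, K / d < N%:R.
  exists (Num.bound (K / d)).
  by rewrite archi_boundP // divr_ge0 // ltW.
have := h N; rewrite -ler_pdivrMr ?exprn_gt0 // -expr_div_n => hK.
have := le_trans (bern _) hK; rewrite ltr_pdivrMr // in hN.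
have : N%:R * d <= (2 ^ N)%:R * d.
  by rewrite ler_pM2r // ler_nat ltnW // ltn_expl.
lra.
Qed.

Lemma ler_of_sqr (R : realDomainType) (x y : R) :
  0 <= y -> x ^+ 2 <= y ^+ 2 -> x <= y.
Proof. by move=> y0 h; rewrite leNgt; apply/negP => xy; nra. Qed.

Lemma gt0_realC_neq0 (R : realType) (t : R) : 0 < t -> t%:C%C != 0 :> R[i].
Proof. by move=> t0; rewrite (_ : 0 = 0%:C%C) // (inj_eq (@complexI _)) gt_eqF. Qed.

Lemma imaginary_sqr (R : realType) : 'i%C * 'i%C = - 1 :> R[i].
Proof.
by apply/eqP; rewrite eq_complex /= !mul0r !mulr1 !mul1r sub0r add0r oppr0 !eqxx.
Qed.

(** * Algebraic rules for the involution *)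

Section Involution.
Variables (R : realType) (A : algType R[i]) (star : A -> A).
Hypothesis starP : is_involution star.

Lemma starK a : star (star a) = a. Proof. by case: starP. Qed.
Lemma starD a b : star (a + b) = star a + star b. Proof. by case: starP. Qed.
Lemma starM a b : star (a * b) = star b * star a. Proof. by case: starP. Qed.

Lemma starZ (t : R) a : star (t%:C%C *: a) = t%:C%C *: star a.
Proof. by case: starP => _ _ -> _; congr (_ *: _); exact: conjc_real. Qed.

Lemma starZi a : star ('i%C *: a) = - 'i%C *: star a.
Proof.
by case: starP => _ _ -> _; congr (_ *: _);
  apply/eqP; rewrite eq_complex /= oppr0 !eqxx.
Qed.

Lemma star0 : star 0 = 0.
Proof. by apply: (addIr (star 0)); rewrite -starD !add0r. Qed.

Lemma starN a : star (- a) = - star a.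
Proof. by apply: (addIr (star a)); rewrite -starD !addNr star0. Qed.

Lemma starB a b : star (a - b) = star a - star b.
Proof. by rewrite starD starN. Qed.

Lemma star1 : star 1 = 1.
Proof. by rewrite -[LHS]mulr1 -{2}[1]starK -starM mulr1 starK. Qed.

Lemma starX a n : star (a ^+ n) = star a ^+ n.
Proof. by elim: n => [|n IH]; rewrite ?expr0 ?star1 // exprS exprSr starM IH. Qed.

Definition starE := (starB, starD, starZ, starZi, starM, starN, star1,
  star0, starK, starX).

End Involution.

Set Default Proof Using "All".

Section Seminorm.
Variables (R : realType) (A : algType R[i]) (star : A -> A) (q : A -> R).
Hypothesis starP : is_involution star.
Hypothesis qP : is_Cstar_seminorm star q.
Local Notation stE := (starE _ _ _ starP).
Local Notation "t *:: a" := (t%:C%C *: a) (at level 40).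

Lemma q_ge0 a : 0 <= q a. Proof. by case: qP. Qed.
Lemma qD a b : q (a + b) <= q a + q b. Proof. by case: qP. Qed.
Lemma qstar a : q (star a * a) = q a ^+ 2. Proof. by case: qP. Qed.

Lemma qZ t a : q (t *:: a) = `|t| * q a.
Proof.
by case: qP => _ _ -> _; rewrite /ComplexField.Normc.normc /= expr0n addr0 sqrtr_sqr.
Qed.

Lemma qZi a : q ('i%C *: a) = q a.
Proof.
case: qP => _ _ -> _.
by rewrite /ComplexField.Normc.normc /= expr0n add0r expr1n sqrtr1 mul1r.
Qed.

Lemma qZp t a : 0 <= t -> q (t *:: a) = t * q a.
Proof. by move=> t0; rewrite qZ ger0_norm. Qed.

Lemma qN a : q (- a) = q a.
Proof.
have -> : - a = (- 1) *:: a by nc_alg.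
by rewrite qZ normrN1 mul1r.
Qed.

Lemma qB a b : q (a - b) <= q a + q b.
Proof. by rewrite -[q b]qN qD. Qed.

Lemma qBC a b : q (a - b) = q (b - a).
Proof. by rewrite -qN opprB. Qed.

Lemma q_tri a b c : q (a - c) <= q (a - b) + q (b - c).
Proof. by apply: le_trans (qD _ _); rewrite addrA subrK. Qed.

Lemma q_split a b : q a <= q b + q (a - b).
Proof. by apply: le_trans (qD _ _); rewrite addrC subrK. Qed.

Lemma q0 : q 0 = 0.
Proof. by rewrite -(scale0r (0 : A)) (_ : 0 = 0%:C%C) // qZp // mul0r. Qed.

(** [q 1] equals its own square, so it is 0 or 1; the value 0 is possible, since [q] may vanish
    identically. *)
Lemma q1_le : q 1 <= 1.
Proof.
have := qstar 1; rewrite (star1 _ _ _ starP) mul1r => h.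
by have := q_ge0 1; nra.
Qed.

Lemma q_polar a b : q (star b * a) <= (q a + q b) ^+ 2.
Proof.
pose c1 := a + b; pose c2 := a - b; pose c3 := a + 'i%C *: b; pose c4 := a - 'i%C *: b.
have i2 := imaginary_sqr R.
have e : 4 *:: (star b * a) = star c1 * c1 - star c2 * c2
    + ('i%C *: (star c3 * c3) - 'i%C *: (star c4 * c4)).
  rewrite /c1 /c2 /c3 /c4 !stE; nc_alg_with ltac:(ring: i2).
have h c : q c <= q a + q b -> q (star c * c) <= (q a + q b) ^+ 2.
  by move=> hc; rewrite qstar; have := q_ge0 c; nra.
have h1 := h _ (qD a b).
have h2 := h _ (qB a b).
have h3 : q (star c3 * c3) <= (q a + q b) ^+ 2.
  by apply: h; rewrite -[q b]qZi; exact: qD.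
have h4 : q (star c4 * c4) <= (q a + q b) ^+ 2.
  by apply: h; rewrite -[q b]qZi; exact: qB.
have : 4 * q (star b * a) <= 4 * (q a + q b) ^+ 2.
  rewrite -qZp // e.
  apply: le_trans (qD _ _) _.
  have := qB (star c1 * c1) (star c2 * c2).
  have := qB ('i%C *: (star c3 * c3)) ('i%C *: (star c4 * c4)).
  rewrite !qZi; lra.
lra.
Qed.

(** Scaling [a] and [b] to seminorm at most 1 in [q_polar] gives (1 + 1)^2 = 4; the added [e] covers
    q a = 0 and q b = 0. *)
Lemma qM_star a b : q (star b * a) <= 4 * q a * q b.
Proof.
apply: (@le_eps_lin _ _ _ (4 * (q a + q b + 1))) => e e0 e1.
have pu : 0 < q a + e by have := q_ge0 a; lra.
have pv : 0 < q b + e by have := q_ge0 b; lra.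
have := q_polar ((q a + e)^-1 *:: a) ((q b + e)^-1 *:: b).
rewrite (starZ _ _ _ starP) -scalerAl -scalerAr.
rewrite !qZp ?invr_ge0 ?(ltW pu) ?(ltW pv) // => h.
have ha : (q a + e)^-1 * q a <= 1 by rewrite mulrC ler_pdivrMr // mul1r; lra.
have hb : (q b + e)^-1 * q b <= 1 by rewrite mulrC ler_pdivrMr // mul1r; lra.
have ha0 : 0 <= (q a + e)^-1 * q a
  by rewrite mulr_ge0 ?q_ge0 ?invr_ge0 ?(ltW pu) ?(ltW pv).
have hb0 : 0 <= (q b + e)^-1 * q b
  by rewrite mulr_ge0 ?q_ge0 ?invr_ge0 ?(ltW pu) ?(ltW pv).
have h4 : (q b + e)^-1 * ((q a + e)^-1 * q (star b * a)) <= 4.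
  by apply: le_trans h _; nra.
rewrite mulrC ler_pdivrMr // mulrC ler_pdivrMr // in h4.
by apply: le_trans h4 _; have := q_ge0 a; have := q_ge0 b; nra.
Qed.

(** With s and t the values at [star a] and [a], the C*-identity, used twice, gives s^4 for a a^* a
    a^*, and [qM_star], used twice, bounds this by 16 s^2 t^2. *)
Lemma q_star4 a : q (star a) <= 4 * q a.
Proof.
have h1 := qM_star (star a * a * star a) (star a).
have h2 := qM_star (star a) (star a * a).
have h3 := qstar (a * star a).
have h4 := qstar (star a).
rewrite !stE in h1 h2 h3 h4; rewrite qstar in h2.
rewrite -mulrA in h3; rewrite !mulrA in h1 h2 h3 *; rewrite h4 in h3.
rewrite {}h3 in h1.
have s0 := q_ge0 (star a); have t0 := q_ge0 a.
set s := q (star a) in h1 h2 s0 *; set t := q a in h1 h2 t0 *.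
rewrite leNgt; apply/negP => st.
have sp : 0 < s by lra.
have : s ^+ 2 * s ^+ 2 <= 16 * t ^+ 2 * s ^+ 2 by nra.
by rewrite ler_pM2r ?exprn_gt0 //; nra.
Qed.

Lemma qM16 a b : q (a * b) <= 16 * q a * q b.
Proof.
have := qM_star b (star a); rewrite !stE.
by have := q_star4 a; have := q_ge0 a; have := q_ge0 b; nra.
Qed.

Lemma q_pow2 h n : star h = h -> q (h ^+ (2 ^ n)) = q h ^+ (2 ^ n).
Proof.
move=> sh; elim: n => [|n IH]; first by rewrite !expr1.
by rewrite expnSr !exprM -IH -qstar (starX _ _ _ starP) sh expr2.
Qed.

Lemma q_sqr h : star h = h -> q (h * h) = q h ^+ 2.
Proof. by move=> sh; rewrite -qstar sh. Qed.

(** Commutation makes [h * k] self-adjoint and splits its powers, so the power trick removes the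
    constant 16 of [qM16]. *)
Lemma qM_comm h k : star h = h -> star k = k -> h * k = k * h ->
  q (h * k) <= q h * q k.
Proof.
move=> sh sk c; apply: (@le_pow2_const _ _ _ 16); rewrite ?mulr_ge0 ?q_ge0 // => n.
rewrite -q_pow2; last by rewrite !stE sh sk.
by rewrite exprMn_comm // exprMn mulrA -!q_pow2 // qM16.
Qed.

(* For U = h + ik, normality gives q(star U) = q U, and h = (U + star U)/2. *)
Lemma q_sqr_le_sumsq h k : star h = h -> star k = k -> h * k = k * h ->
  q h ^+ 2 <= q (h * h + k * k).
Proof.
move=> sh sk c; pose U := h + 'i%C *: k.
have i2 := imaginary_sqr R.
have e1 : star U * U = h * h + k * k.
  by rewrite /U !stE sh sk; comm_alg_with ltac:(ring: i2).
have e2 : star (star U) * star U = h * h + k * k.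
  by rewrite /U !stE sh sk; comm_alg_with ltac:(ring: i2).
have h1 := qstar U; have h2 := qstar (star U); rewrite e1 in h1; rewrite e2 in h2.
have e3 : 2 *:: h = U + star U by rewrite /U !stE sh sk; nc_alg.
have h3 : 2 * q h <= q U + q (star U) by rewrite -qZp // e3 qD.
rewrite h1; have := q_ge0 U; have := q_ge0 (star U); have := q_ge0 h.
move=> a1 a2 a3.
have h12 : q U = q (star U).
  by apply/eqP; rewrite eq_le; apply/andP; split; nra.
by nra.
Qed.

(** [k] lies in the bicommutant of [a]; this is how two approximate roots of [a] obtained separately
    are seen to commute. *)
Definition bicommutes (a k : A) := forall c, c * a = a * c -> c * k = k * c.

(* v_{n+1} = (u + v_n^2)/2 converges to 1 - sqrt (1 - u); the numbers [rsq n]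
   are its values at u = 1 and dominate it, because all its coefficients are
   nonnegative. *)
Fixpoint sqit (u : A) (n : nat) : A :=
  if n is n'.+1 then 2^-1 *:: (u + sqit u n' * sqit u n') else 0.

Fixpoint rsq (n : nat) : R := if n is n'.+1 then (1 + rsq n' ^+ 2) / 2 else 0.

Lemma rsq_bounds n : 0 <= rsq n <= 1.
Proof.
elim: n => [|n /andP[h1 h2]] /=; first by rewrite lexx ler01.
by apply/andP; split; nra.
Qed.

(** The increments telescope within [0, 1], so they cannot all be at least [e]. *)
Lemma rsq_gap e : 0 < e -> exists n, rsq n.+1 - rsq n < e.
Proof.
move=> e0; apply: contrapT => h.
have h' n : e <= rsq n.+1 - rsq n.
  by rewrite leNgt; apply/negP => hn; apply: h; exists n.
have hn n : n%:R * e <= rsq n.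
  elim: n => [|n IH]; first by rewrite mul0r.
  by rewrite -natr1 mulrDl mul1r; have := h' n; lra.
have h1 := hn (Num.bound e^-1).
have : 1 < (Num.bound e^-1)%:R * e.
  by rewrite -ltr_pdivrMr // mul1r archi_boundP // invr_ge0 ltW.
by have /andP[_] := rsq_bounds (Num.bound e^-1); lra.
Qed.

Lemma sqit_star u n : star u = u -> star (sqit u n) = sqit u n.
Proof. by move=> su; elim: n => [|n IH] /=; rewrite !stE // IH su. Qed.

Lemma sqit_comm u n : bicommutes u (sqit u n).
Proof.
move=> c hc; elim: n => [|n IH] /=; first by rewrite mulr0 mul0r.
by rewrite -scalerAr -scalerAl mulrDr mulrDl hc mulrA IH -!mulrA IH.
Qed.

Lemma sqit_comm2 u m n : sqit u m * sqit u n = sqit u n * sqit u m.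
Proof. by apply: sqit_comm; symmetry; apply: sqit_comm. Qed.

(** The recursion v_{n+2} - v_{n+1} = (v_{n+1} - v_n) (v_{n+1} + v_n) / 2 also holds for [rsq], and
    [qM_comm] carries the bounds along. *)
Lemma sqit_bounds u n : star u = u -> q u <= 1 ->
  q (sqit u n) <= rsq n /\ q (sqit u n.+1 - sqit u n) <= rsq n.+1 - rsq n.
Proof.
move=> su qu; have V2 : 0 <= 2^-1 :> R by rewrite invr_ge0.
elim: n => [|n [IH1 IH2]].
  rewrite /= mulr0 addr0 subr0 q0 expr0n addr0 subr0 qZp //; lra.
have s1 := sqit_star u n su; have s2 := sqit_star u n.+1 su.
have c := sqit_comm2 u n n.+1.
have q1 : q (sqit u n.+1) <= rsq n.+1.
  rewrite /= qZp //; have := qD u (sqit u n * sqit u n).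
  rewrite q_sqr //; have := q_ge0 (sqit u n); nra.
split=> //.
have -> : sqit u n.+2 - sqit u n.+1
    = 2^-1 *:: ((sqit u n.+1 - sqit u n) * (sqit u n.+1 + sqit u n)).
  have -> : sqit u n.+2 = 2^-1 *:: (u + sqit u n.+1 * sqit u n.+1) by [].
  rewrite {3}[sqit u n.+1](_ : _ = 2^-1 *:: (u + sqit u n * sqit u n)) //.
  move: c (sqit_comm u n.+1 u erefl) (sqit_comm u n u erefl).
  by move: (sqit u n.+1) (sqit u n) => x y c cx cy; comm_alg.
rewrite qZp //.
have hM : q ((sqit u n.+1 - sqit u n) * (sqit u n.+1 + sqit u n)) <=
    q (sqit u n.+1 - sqit u n) * q (sqit u n.+1 + sqit u n).
  move: s1 s2 c; move: (sqit u n.+1) (sqit u n) => x y s1 s2 c.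
  by apply: qM_comm; rewrite ?stE ?s1 ?s2 //; comm_alg.
have eq_rsq : rsq n.+2 - rsq n.+1
    = 2^-1 * ((rsq n.+1 - rsq n) * (rsq n.+1 + rsq n)).
  rewrite [rsq n.+2](_ : _ = (1 + rsq n.+1 ^+ 2) / 2) //.
  by rewrite {2}[rsq n.+1](_ : _ = (1 + rsq n ^+ 2) / 2) //; field.
rewrite eq_rsq ler_wpM2l //; apply: (le_trans hM).
apply: ler_pM; rewrite ?q_ge0 //.
by apply: le_trans (qD _ _) _; apply: lerD.
Qed.

(** The root is 1 - v_n; the defect of its square is 2 (v_{n+1} - v_n), so one small increment is
    enough. *)
Lemma sqrt_one_sub u e : star u = u -> q u <= 1 -> 0 < e ->
  exists k, [/\ star k = k, bicommutes u k, q (1 - k) <= 1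
             & q (k * k - (1 - u)) <= e].
Proof.
move=> su qu e0; have e2 : 0 < e / 2 by lra.
have [n hn] := rsq_gap _ e2.
have [h1 h2] := sqit_bounds u n su qu.
exists (1 - sqit u n); split.
- by rewrite !stE sqit_star.
- by move=> c hc; rewrite mulrBr mulrBl mulr1 mul1r (sqit_comm u n c hc).
- by rewrite opprB addrC subrK; have /andP[_] := rsq_bounds n; lra.
- have -> : (1 - sqit u n) * (1 - sqit u n) - (1 - u)
      = 2 *:: (sqit u n.+1 - sqit u n).
    rewrite /=; move: (sqit u n) => v; nc_alg_with ltac:(by field).
  by rewrite qZp //; lra.
Qed.

(** * Positivity with respect to a C*-seminorm *)

(** In a C*-algebra, a self-adjoint a satisfies || t - a || <= t exactly when its spectrum lies in
    [0, 2 t]. *)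
Definition psd (a : A) := star a = a /\ exists t, q (t *:: 1 - a) <= t.

Lemma psd_star a : psd a -> star a = a. Proof. by case. Qed.

Lemma psdD a b : psd a -> psd b -> psd (a + b).
Proof.
move=> [sa [s ha]] [sb [t hb]]; split; first by rewrite !stE sa sb.
exists (s + t).
have -> : (s + t) *:: 1 - (a + b) = (s *:: 1 - a) + (t *:: 1 - b) by nc_alg.
by apply: le_trans (qD _ _) _; lra.
Qed.

Lemma psdZ s a : 0 <= s -> psd a -> psd (s *:: a).
Proof.
move=> s0 [sa [t ha]]; split; first by rewrite !stE sa.
exists (s * t).
have -> : (s * t) *:: 1 - s *:: a = s *:: (t *:: 1 - a) by nc_alg.
by rewrite qZp // ler_wpM2l.
Qed.

Lemma psd_shift T a : star a = a -> q a <= T -> psd (T *:: 1 - a).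
Proof.
move=> sa h; split; first by rewrite !stE sa.
by exists T; rewrite opprB addrC subrK.
Qed.

Lemma psd_const c : 0 <= c -> psd (c *:: 1).
Proof. by move=> c0; split; [rewrite !stE|exists c; rewrite subrr q0]. Qed.

Lemma psd1 : psd 1.
Proof. by have := psd_const 1 ler01; rewrite scale1r. Qed.

Lemma psd_sqrt a e : psd a -> 0 < e ->
  exists k, [/\ star k = k, bicommutes a k, psd k & q (k * k - a) <= e].
Proof.
move=> [sa [t ht]] e0.
(* Writing a = T (1 - u) with q u <= 1 reduces to [sqrt_one_sub]. As [t] may be 0, T = t + 1 is
   taken. *)
have [T T0 hT] : exists2 T, 0 < T & q (T *:: 1 - a) <= T.
  exists (t + 1).
    by rewrite ltr_wpDl //; apply: le_trans ht; exact: q_ge0.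
  have -> : (t + 1) *:: 1 - a = (t *:: 1 - a) + 1 by nc_alg.
  by apply: le_trans (qD _ _) _; have := q1_le; lra.
have Tn : T%:C%C != 0 :> R[i] by exact: gt0_realC_neq0.
pose u := T^-1 *:: (T *:: 1 - a).
have su : star u = u by rewrite /u !stE sa.
have qu : q u <= 1.
  by rewrite /u qZp ?invr_ge0 ?(ltW T0) // mulrC ler_pdivrMr // mul1r.
have [k [sk ck k1 hk]] := sqrt_one_sub u (e / T) su qu (divr_gt0 e0 T0).
pose s := Num.sqrt T.
have s0 : 0 <= s by rewrite sqrtr_ge0.
have ss : s * s = T by rewrite -expr2 sqr_sqrtr // ltW.
exists (s *:: k); split.
- by rewrite !stE sk.
- move=> c hc; rewrite -scalerAr -scalerAl; congr (_ *: _); apply: ck.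
  by rewrite /u -scalerAr -scalerAl mulrBr mulrBl hc -scalerAr -scalerAl mulr1 mul1r.
- apply: psdZ => //; split=> //; exists 1.
  by rewrite scale1r.
- have -> : (s *:: k) * (s *:: k) - a = T *:: (k * k - (1 - u)).
    have -> : (s *:: k) * (s *:: k) = T *:: (k * k) by rewrite -ss; nc_alg.
    rewrite /u fmorphV /=; nc_alg_with ltac:(by field).
  by rewrite qZp ?(ltW T0) // mulrC -ler_pdivlMr.
Qed.

(** An approximate root k of 1 - h^2 commutes with h, and k^2 + h^2 is near 1, so [q_sqr_le_sumsq]
    bounds (q k)^2 and thus q (1 - h^2). *)
Lemma q_one_sub_sq h : star h = h -> q h <= 1 -> q (1 - h * h) <= 1.
Proof.
move=> sh qh; apply: (@le_eps_lin _ _ _ 2) => e e0 _.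
have su : star (h * h) = h * h by rewrite !stE sh.
have qu : q (h * h) <= 1 by rewrite q_sqr //; have := q_ge0 h; nra.
have [k [sk ck _ hk]] := sqrt_one_sub _ _ su qu e0.
have c : k * h = h * k by symmetry; apply: ck; rewrite mulrA.
have h1 := q_sqr_le_sumsq _ _ sk sh c.
have h2 := qD (k * k - (1 - h * h)) 1.
rewrite (_ : k * k - (1 - h * h) + 1 = k * k + h * h) in h2; last by nc_alg.
have h3 := q_split (1 - h * h) (k * k).
rewrite [q (_ - k * k)]qBC (q_sqr k sk) in h3.
by have := q1_le; lra.
Qed.

Lemma q_const_sub_sq T h : star h = h -> 0 < T -> q h ^+ 2 <= T ->
  q (T *:: 1 - h * h) <= T.
Proof.
move=> sh T0 hT; pose s := Num.sqrt T.
have s0 : 0 < s by rewrite sqrtr_gt0.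
have ss : s ^+ 2 = T by rewrite sqr_sqrtr // ltW.
have sn : s%:C%C != 0 :> R[i] by exact: gt0_realC_neq0.
have h1 : q (1 - (s^-1 *:: h) * (s^-1 *:: h)) <= 1.
  apply: q_one_sub_sq; first by rewrite !stE sh.
  rewrite qZp ?invr_ge0 ?(ltW s0) // mulrC ler_pdivrMr // mul1r.
  by apply: ler_of_sqr; rewrite ?(ltW s0) // ss.
have -> : T *:: 1 - h * h = T *:: (1 - (s^-1 *:: h) * (s^-1 *:: h)).
  by rewrite -ss fmorphV /=; nc_alg_with ltac:(by field).
by rewrite qZp ?(ltW T0) // -[leRHS]mulr1 ler_wpM2l ?(ltW T0).
Qed.

Lemma psd_sq h : star h = h -> psd (h * h).
Proof.
move=> sh; split; first by rewrite !stE sh.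
exists (q h ^+ 2 + 1); apply: q_const_sub_sq => //; have := sqr_ge0 (q h); lra.
Qed.

(** Frees the [t] of [psd] from its existential. With b near k^2, [q_const_sub_sq] gives the bound
    for k^2; three errors of size e account for the 3. *)
Lemma psd_bound b t : psd b -> q b <= t -> q (t *:: 1 - b) <= t.
Proof.
move=> pb bt; apply: (@le_eps_lin _ _ _ 3) => e e0 _.
have t0 : 0 <= t by apply: le_trans bt; exact: q_ge0.
have [k [sk _ _ hk]] := psd_sqrt _ _ pb e0.
have h1 := q_split (k * k) b; rewrite (q_sqr k sk) in h1.
have h2 : q ((t + e) *:: 1 - k * k) <= t + e by apply: q_const_sub_sq => //; lra.
have -> : t *:: 1 - b = ((t + e) *:: 1 - k * k) + (k * k - b) - e *:: 1 by nc_alg.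
apply: le_trans (qB _ _) _; rewrite qZp ?(ltW e0) //.
have := qD ((t + e) *:: 1 - k * k) (k * k - b).
have := q1_le; have := q_ge0 1; nra.
Qed.

(** By [psd_bound] an approximation b admits the witness q a + K e, which tends to q a. *)
Lemma psd_closed a K : star a = a ->
  (forall e, 0 < e -> e <= 1 -> exists2 b, psd b & q (a - b) <= K * e) -> psd a.
Proof.
move=> sa h; split=> //; exists (q a); apply: (@le_eps_lin _ _ _ (3 * K)) => e e0 e1.
have [b pb hb] := h e e0 e1.
have h1 := q_split b a; rewrite [q (b - a)]qBC in h1.
have h2 : q ((q a + K * e) *:: 1 - b) <= q a + K * e by apply: psd_bound => //; lra.
have Ke : 0 <= K * e by apply: le_trans hb; exact: q_ge0.
have -> : q a *:: 1 - a = ((q a + K * e) *:: 1 - b) - (a - b) - (K * e) *:: 1 by nc_alg.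
apply: le_trans (qB _ _) _; rewrite qZp //.
have := qB ((q a + K * e) *:: 1 - b) (a - b).
have := q1_le; have := q_ge0 1; nra.
Qed.

(** Approximate roots k and l commute by the bicommutant property, so (k l)^2 is a positive
    approximation of a b. *)
Lemma psdM a b : psd a -> psd b -> a * b = b * a -> psd (a * b).
Proof.
move=> pa pb c; apply: (@psd_closed _ (16 * q a + 16 * (q b + 1))).
  by rewrite !stE !psd_star // c.
move=> e e0 e1.
have [k [sk ck _ hk]] := psd_sqrt _ _ pa e0.
have [l [sl cl _ hl]] := psd_sqrt _ _ pb e0.
have clk : k * l = l * k.
  by apply: cl; symmetry; apply: ck; rewrite c.
exists ((k * l) * (k * l)); first by apply: psd_sq; rewrite !stE sk sl.
have -> : (k * l) * (k * l) = (k * k) * (l * l) by comm_alg.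
have -> : a * b - k * k * (l * l) = a * (b - l * l) + (a - k * k) * (l * l).
  by nc_alg.
apply: le_trans (qD _ _) _.
have := qM16 a (b - l * l); have := qM16 (a - k * k) (l * l).
rewrite [q (a - _)]qBC [q (b - _)]qBC.
have := q_split (l * l) b.
have := q_ge0 a; have := q_ge0 b; have := q_ge0 (l * l).
have := q_ge0 (k * k - a); have := q_ge0 (l * l - b).
move=> a1 a2 a3 a4 a5 a6 a7 a8.
have : q a * q (l * l - b) <= q a * e by rewrite ler_wpM2l.
have : q (k * k - a) * q (l * l) <= e * (q b + 1) by apply: ler_pM => //; lra.
lra.
Qed.

Lemma psdX a n : psd a -> psd (a ^+ n).
Proof.
move=> pa; elim: n => [|n IH]; first by rewrite expr0; exact: psd1.
by rewrite exprS; apply: psdM => //; rewrite -exprS exprSr.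
Qed.

(** 1 - k^2 = (1 - k) (1 + k) is positive and has an approximate root w; then k^2 + w^2 is near 1
    and bounds (q k)^2. *)
Lemma q_interval1 k : psd (1 - k) -> psd (1 + k) -> q k <= 1.
Proof.
move=> p1 p2.
have sk : star k = k.
  by have := psd_star _ p2; rewrite !stE => /addrI.
have p3 : psd (1 - k * k).
  have -> : 1 - k * k = (1 - k) * (1 + k) by nc_alg.
  by apply: psdM => //; nc_alg.
apply: ler_of_sqr => //; rewrite expr1n.
apply: (@le_eps_lin _ _ _ 1) => e e0 _; rewrite mul1r.
have [w [sw cw _ hw]] := psd_sqrt _ _ p3 e0.
have c : k * w = w * k by apply: cw; nc_alg.
apply: le_trans (q_sqr_le_sumsq _ _ sk sw c) _.
have -> : k * k + w * w = 1 + (w * w - (1 - k * k)) by nc_alg.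
by apply: le_trans (qD _ _) _; have := q1_le; lra.
Qed.

Lemma q_interval T k : 0 < T -> psd (T *:: 1 - k) -> psd (T *:: 1 + k) -> q k <= T.
Proof.
move=> T0 p1 p2.
have Tn : T%:C%C != 0 :> R[i] by exact: gt0_realC_neq0.
have V0 : 0 <= T^-1 by rewrite invr_ge0 ltW.
have : q (T^-1 *:: k) <= 1.
  apply: q_interval1.
    have -> : 1 - T^-1 *:: k = T^-1 *:: (T *:: 1 - k).
      by rewrite fmorphV /=; nc_alg_with ltac:(by field).
    exact: psdZ.
  have -> : 1 + T^-1 *:: k = T^-1 *:: (T *:: 1 + k).
    by rewrite fmorphV /=; nc_alg_with ltac:(by field).
  exact: psdZ.
by rewrite qZp // mulrC ler_pdivrMr // mul1r.
Qed.

Lemma psd_q_le u v : psd u -> psd (v - u) -> q u <= q v.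
Proof.
move=> pu pvu; apply: (@le_eps_lin _ _ _ 1) => e e0 _; rewrite mul1r.
have qv := q_ge0 v.
have sv : star v = v.
  by have := psd_star _ pvu; rewrite !stE (psd_star _ pu) => /addIr.
have T0 : 0 < q v + e by lra.
apply: q_interval => //.
  have -> : (q v + e) *:: 1 - u = ((q v + e) *:: 1 - v) + (v - u) by nc_alg.
  by apply: psdD => //; apply: psd_shift => //; lra.
by apply: psdD => //; apply: psd_const; lra.
Qed.

Lemma q_X_le m n : star m = m -> q (m ^+ n) <= q m ^+ n.
Proof.
move=> sm; elim: n => [|n IH]; first by rewrite !expr0 q1_le.
rewrite !exprS; apply: le_trans (ler_wpM2l (q_ge0 m) IH).
by apply: qM_comm; rewrite ?(starX _ _ _ starP) ?sm // -exprS -exprSr.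
Qed.

(** For the lower bound, a power m^(2^N), whose seminorm is known exactly, is split into two
    factors, and the power of q m coming from the second one cancels. Exponent 0 is excluded because
    [q 1] may be 0. *)
Lemma q_X m n : star m = m -> q (m ^+ n.+1) = q m ^+ n.+1.
Proof.
move=> sm; apply/eqP; rewrite eq_le q_X_le //=.
have [q0m|qn] := eqVneq (q m) 0; first by rewrite q0m expr0n q_ge0.
have qp : 0 < q m by rewrite lt_def qn q_ge0.
have hN : (n.+1 <= 2 ^ n.+1)%N by rewrite ltnW // ltn_expl.
have := q_pow2 m n.+1 sm.
rewrite -(subnKC hN) !exprD => h.
have : q m ^+ n.+1 * q m ^+ (2 ^ n.+1 - n.+1)
    <= q (m ^+ n.+1) * q m ^+ (2 ^ n.+1 - n.+1).
  rewrite -h; apply: le_trans (ler_wpM2l (q_ge0 _) (q_X_le _ _ sm)).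
  by apply: qM_comm; rewrite ?(starX _ _ _ starP) ?sm // -!exprD addnC.
by rewrite ler_pM2r // exprn_gt0.
Qed.

(* The spectra of b^* b and b b^* agree away from 0: with m = t - b^* b and
   l = t - b b^*, one has b^* b m^n = b^* l^n b. *)
Lemma q_transfer b t : 0 <= t -> t < q (t *:: 1 - star b * b) ->
  q (t *:: 1 - star b * b) <= q (t *:: 1 - b * star b).
Proof.
move=> t0; set m := t *:: 1 - star b * b; set l := t *:: 1 - b * star b => tm.
have sm : star m = m by rewrite /m !stE.
have sl : star l = l by rewrite /l !stE.
have bm n : b * m ^+ n = l ^+ n * b.
  elim: n => [|n IH]; first by rewrite !expr0 mulr1 mul1r.
  rewrite exprSr mulrA IH exprSr -!mulrA; congr (_ * _).
  by rewrite /m /l; nc_alg.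
(* From t m^N - m^(N+1) = b^* l^N b one gets (q m - t) (q m)^N <= 256 q (star b) q b (q l)^N;
   dividing by q m - t > 0 yields this constant. *)
set K := 16 * (16 * q (star b)) * q b / (q m - t).
have d0 : 0 < q m - t by lra.
apply: (@le_pow2_const _ _ _ K); rewrite ?q_ge0 // => n.
set N := (2 ^ n)%N.
have e : t *:: m ^+ N - m ^+ N.+1 = star b * l ^+ N * b.
  by rewrite -mulrA -bm exprS /m; nc_alg.
have h1 : q (star b * l ^+ N * b) <= 16 * (16 * q (star b) * q l ^+ N) * q b.
  apply: le_trans (qM16 _ _) _; rewrite ler_wpM2r ?q_ge0 // ler_wpM2l //.
  apply: le_trans (qM16 _ _) _; rewrite ler_wpM2l ?q_X_le //.
  by rewrite mulr_ge0 ?q_ge0.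
have h2 := q_split (m ^+ N.+1) (t *:: m ^+ N).
rewrite [q (_ - _)]qBC e q_X // qZp // exprS in h2.
have h3 : q (m ^+ N) = q m ^+ N by rewrite /N q_pow2.
rewrite h3 in h2.
rewrite /K mulrAC ler_pdivlMr //; lra.
Qed.

(** Passing from n to n + 1 adds m^n (1 - m)^2, a product of commuting positive elements. *)
Lemma psd_one_sub_powD m n : psd m -> star m = m ->
  psd (1 - m ^+ n + m ^+ n.+1).
Proof.
move=> pm sm; elim: n => [|n IH]; first by rewrite expr0 expr1 subrr add0r.
have -> : 1 - m ^+ n.+1 + m ^+ n.+2
    = (1 - m ^+ n + m ^+ n.+1) + m ^+ n * ((1 - m) * (1 - m)).
  by rewrite !exprSr; nc_alg.
apply: psdD => //; apply: psdM.
- exact: psdX.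
- by apply: psd_sq; rewrite !stE sm.
- have c : m ^+ n * m = m * m ^+ n by rewrite -exprS -exprSr.
  by move: c; move: (m ^+ n) => p c; comm_alg.
Qed.

(* If h = b^* b had negative spectrum, then for m = 1 - h and c = b m^n the
   element c^* c = m^(2n) - m^(2n+1) would be <= 1 with norm unbounded in n;
   but c^* c + c c^* >= 0 forces c c^* >= - 1, hence c^* c >= - 1. *)
Lemma psd_starM_le1 b : q (star b * b) <= 1 -> psd (star b * b).
Proof.
move=> qh; set h := star b * b in qh *.
have sh : star h = h by rewrite /h !stE.
split=> //; exists 1; rewrite scale1r; set m := 1 - h.
have sm : star m = m by rewrite /m /h !stE.
have pm : psd m.
  by have := psd_shift 1 h sh qh; rewrite scale1r.
rewrite leNgt; apply/negP => m1.
have m0 : 0 < q m - 1 by lra.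
suff : q m ^+ 2 <= 1 by nra.
apply: (@le_pow2_const _ _ _ (q m - 1)^-1); rewrite ?sqr_ge0 // => j.
set n := (2 ^ j)%N; rewrite expr1n mulr1.
pose c := b * m ^+ n; pose k := star c * c; pose l := c * star c.
have sk : star k = k by rewrite /k !stE.
have sl : star l = l by rewrite /l !stE.
have ek : k = m ^+ (2 * n) - m ^+ (2 * n).+1.
  rewrite /k /c (starM _ _ _ starP) (starX _ _ _ starP) sm.
  have -> : m ^+ n * star b * (b * m ^+ n) = m ^+ n * h * m ^+ n.
    by rewrite /h; nc_alg.
  have -> : h = 1 - m by rewrite /m opprB addrC subrK.
  have cm : m ^+ n * m = m * m ^+ n by rewrite -exprS -exprSr.
  rewrite exprS mulnC muln2 -addnn exprD.
  by move: cm; move: (m ^+ n) => p cm; comm_alg.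
have p1 : psd (1 - k).
  have -> : 1 - k = 1 - m ^+ (2 * n) + m ^+ (2 * n).+1 by rewrite ek; nc_alg.
  exact: psd_one_sub_powD.
have p2 : psd (k + l).
  pose y := 'i%C *: (star c - c).
  have i2 := imaginary_sqr R.
  have -> : k + l = 2^-1 *:: ((c + star c) * (c + star c) + y * y).
    rewrite /k /l /y fmorphV /=; nc_alg_with ltac:(by field: i2).
  apply: psdZ; first by rewrite invr_ge0.
  apply: psdD; apply: psd_sq; first by rewrite !stE addrC.
  by rewrite /y !stE; nc_alg.
have p3 : psd (1 + l).
  have -> : 1 + l = (1 - k) + (k + l) by nc_alg.
  exact: psdD.
(* As q (1 + l) <= T + 1, [psd_bound] gives q (T - l) <= T + 1. [q_transfer] passes this on to k,
   and T - k = (T + 1) - (1 + k) turns it into positivity of 1 + k. *)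
pose T := 1 + q l.
have T0 : 0 <= T by have := q_ge0 l; rewrite /T; lra.
have qTl : q (T *:: 1 - l) <= T + 1.
  have -> : T *:: 1 - l = (T + 1) *:: 1 - (1 + l) by nc_alg.
  apply: psd_bound => //; apply: le_trans (qD _ _) _.
  by have := q1_le; rewrite /T; lra.
have qTk : q (T *:: 1 - k) <= T + 1.
  have [hk|hk] := lerP (q (T *:: 1 - k)) T; first by lra.
  exact: le_trans (q_transfer c T T0 hk) qTl.
have p4 : psd (1 + k).
  split; first by rewrite (starD _ _ _ starP) (star1 _ _ _ starP) sk.
  by exists (T + 1); rewrite (_ : _ - _ = T *:: 1 - k) //; nc_alg.
(* q k <= 1 gives (q m)^(2n+1) <= (q m)^(2n) + 1, which is where the constant (q m - 1)^-1 comes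
   from. *)
have := q_interval1 k p1 p4.
have hq := q_split (m ^+ (2 * n).+1) (m ^+ (2 * n)).
rewrite [q (_ - _)]qBC -ek q_X // in hq.
have -> : (q m ^+ 2) ^+ n = q m ^+ (2 * n) by rewrite exprM.
have h3 : q (m ^+ (2 * n)) = q m ^+ (2 * n) by rewrite /n -expnS q_pow2.
rewrite h3 exprS in hq => qk.
by rewrite -[leRHS]mul1r ler_pdivlMr //; lra.
Qed.

Lemma psd_starM b : psd (star b * b).
Proof.
pose s := q b + 1; have s0 : 0 < s by have := q_ge0 b; rewrite /s; lra.
have sn : s%:C%C != 0 :> R[i] by exact: gt0_realC_neq0.
have -> : star b * b = (s * s) *:: (star (s^-1 *:: b) * (s^-1 *:: b)).
  by rewrite !stE fmorphV /=; nc_alg_with ltac:(by field).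
apply: psdZ; first by rewrite mulr_ge0 // ltW.
apply: psd_starM_le1; rewrite qstar qZp ?invr_ge0 ?(ltW s0) //.
have : s^-1 * q b <= 1 by rewrite mulrC ler_pdivrMr // mul1r /s; lra.
have : 0 <= s^-1 * q b by rewrite mulr_ge0 ?q_ge0 // invr_ge0 ltW.
nra.
Qed.

Lemma psd_conj a v : psd v -> psd (star a * v * a).
Proof.
move=> pv; apply: (@psd_closed _ (16 * (16 * q (star a)) * q a)).
  by rewrite !stE (psd_star _ pv) mulrA.
move=> e e0 _; have [k [sk _ _ hk]] := psd_sqrt _ _ pv e0.
exists (star (k * a) * (k * a)); first exact: psd_starM.
have -> : star a * v * a - star (k * a) * (k * a) = star a * (v - k * k) * a.
  by rewrite !stE sk; nc_alg.
apply: le_trans (qM16 _ _) _; rewrite qBC in hk.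
have := qM16 (star a) (v - k * k); have := q_ge0 (star a); have := q_ge0 a.
move=> a1 a2 a3.
have h : q (star a * (v - k * k)) <= 16 * q (star a) * e.
  by apply: le_trans a3 _; rewrite ler_wpM2l // mulr_ge0.
have : q (star a * (v - k * k)) * q a <= 16 * q (star a) * e * q a.
  by rewrite ler_wpM2r.
lra.
Qed.

(** Conjugating a^* a <= q (a^* a) by b compares the squares; this removes the constant of
    [qM16]. *)
Lemma qM a b : q (a * b) <= q a * q b.
Proof.
apply: ler_of_sqr; first by rewrite mulr_ge0 ?q_ge0.
rewrite exprMn -!qstar -[q (star a * a)]ger0_norm ?q_ge0 // -qZ.
apply: psd_q_le; first exact: psd_starM.
have -> : q (star a * a) *:: (star b * b) - star (a * b) * (a * b)
    = star b * (q (star a * a) *:: 1 - star a * a) * b.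
  by rewrite !stE; nc_alg.
by apply: psd_conj; apply: psd_shift => //; rewrite !stE.
Qed.

Lemma q_star a : q (star a) = q a.
Proof.
have le c : q c <= q (star c).
  have := qM (star c) c; rewrite qstar.
  have := q_ge0 c; have := q_ge0 (star c) => h1 h2 h3.
  by rewrite leNgt; apply/negP => h4; nra.
by apply/eqP; rewrite eq_le le -{2}[a](starK _ _ _ starP) le.
Qed.

(** * Resolvents *)

(** (r + a)^2 >= r^2, conjugated by y. It turns small residuals of two approximate inverses into
    closeness of the inverses. *)
Lemma psd_lower a r y : psd a -> 0 < r -> r * q y <= q ((r *:: 1 + a) * y).
Proof.
move=> pa r0; apply: ler_of_sqr; first exact: q_ge0.
have pr : psd (r *:: 1 + a) by apply: psdD => //; apply: psd_const; exact: ltW.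
rewrite exprMn -!qstar -qZp ?sqr_ge0 //.
apply: psd_q_le; first by apply: psdZ; [exact: sqr_ge0|exact: psd_starM].
have -> : star ((r *:: 1 + a) * y) * ((r *:: 1 + a) * y) - (r ^+ 2) *:: (star y * y)
    = star y * ((2 * r) *:: a + a * a) * y.
  by rewrite !stE (psd_star _ pa); nc_alg.
apply: psd_conj; apply: psdD; last by apply: psd_sq; exact: psd_star.
by apply: psdZ => //; lra.
Qed.

(** r + a = T (1 - u) with T = r + t and q u <= t / T < 1, so a partial Neumann series serves; its
    length is a power of 2 because [le_pow2_const] supplies the decay. *)
Lemma psd_right_inv_approx a r e : psd a -> 0 < r -> 0 < e ->
  exists b, q ((r *:: 1 + a) * b - 1) <= e.
Proof.
move=> [sa [t ht]] r0 e0.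
have t0 : 0 <= t by apply: le_trans ht; exact: q_ge0.
have [T T0 eT] : exists2 T, 0 < T & T = r + t by exists (r + t); lra.
have Tn := gt0_realC_neq0 _ _ T0.
pose u := T^-1 *:: (t *:: 1 - a).
have su : star u = u by rewrite /u !stE sa.
have qu : q u <= t / T.
  by rewrite /u qZp ?invr_ge0 ?(ltW T0) // mulrC ler_wpM2r // invr_ge0 ltW.
have [n hn] : exists n, (t / T) ^+ (2 ^ n) <= e.
  apply: contrapT => hn.
  have : 1 <= t / T.
    apply: (@le_pow2_const _ _ _ e^-1) => //; first by rewrite divr_ge0 // ltW.
    move=> n; rewrite expr1n mulrC ler_pdivlMr // mul1r leNgt.
    by apply/negP => /ltW h; apply: hn; exists n.
  by rewrite ler_pdivlMr // mul1r; lra.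
have geo N : exists b, 1 - u ^+ N = (1 - u) * b.
  elim: N => [|N [b hb]]; first by exists 0; rewrite expr0 subrr mulr0.
  exists (b + u ^+ N); rewrite mulrDr -hb exprS; nc_alg.
have [b hb] := geo (2 ^ n)%N; exists (T^-1 *:: b).
have -> : (r *:: 1 + a) * (T^-1 *:: b) - 1 = - u ^+ (2 ^ n).
  have -> : - u ^+ (2 ^ n) = (1 - u) * b - 1 by rewrite -hb; nc_alg.
  have -> : r = T - t by lra.
  by rewrite /u fmorphV /=; nc_alg_with ltac:(by field).
rewrite qN; apply: le_trans (q_X_le _ _ su) (le_trans _ hn).
by rewrite lerXn2r // nnegrE ?q_ge0 // divr_ge0 // ltW.
Qed.

Lemma psd_resolvent_bounds a r w : psd a -> 0 < r -> w * (r *:: 1 + a) = 1 ->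
  (r *:: 1 + a) * w = 1 -> psd w -> r * q w <= 1 /\ q (a * w) <= 1.
Proof.
move=> pa r0 wm mw pw; split.
  by apply: le_trans (psd_lower a r w pa r0) _; rewrite mw q1_le.
have c : a * w = w * a.
  have -> : a * w = (r *:: 1 + a) * w - r *:: w by nc_alg.
  have -> : w * a = w * (r *:: 1 + a) - r *:: w by nc_alg.
  by rewrite mw wm.
apply: le_trans q1_le; apply: psd_q_le; first exact: psdM.
have -> : 1 - a * w = r *:: w by rewrite -mw; nc_alg.
by apply: psdZ => //; exact: ltW.
Qed.

(** (k^2 - l^2)^2 exceeds (k - l)^4 by 4 (k - l)^2 k l >= 0. This estimate makes approximate square
    roots Cauchy. *)
Lemma q_sub_sqr_le k l : psd k -> psd l -> k * l = l * k ->
  q (k - l) ^+ 2 <= q (k * k - l * l).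
Proof.
move=> pk pl c.
have sk := psd_star _ pk; have sl := psd_star _ pl.
have sd : star (k - l) = k - l by rewrite !stE sk sl.
have sd2 : star ((k - l) * (k - l)) = (k - l) * (k - l) by rewrite !stE sk sl.
rewrite -q_sqr //; apply: ler_of_sqr; first exact: q_ge0.
rewrite -!q_sqr //; last by rewrite !stE sk sl.
apply: psd_q_le; first exact: psd_sq.
have -> : (k * k - l * l) * (k * k - l * l)
    - (k - l) * (k - l) * ((k - l) * (k - l)) = 4 *:: ((k - l) * (k - l) * (k * l)).
  comm_alg.
apply: psdZ => //; apply: psdM; [exact: psd_sq|exact: psdM|comm_alg].
Qed.

End Seminorm.

(** * Locally C*-algebras *)

Section LocallyCstarAlgebra.
Variables (R : realType) (A : algType R[i]) (star : A -> A).
Variables (Lam : Type) (p : Lam -> A -> R).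
Hypothesis hA : locally_Cstar_algebra star p.
Local Notation "t *:: a" := (t%:C%C *: a) (at level 40).
Local Notation "lem $ al" := (lem _ _ _ _ (proj1 hA) (proj1 (proj2 hA) al))
  (at level 9, al at level 0).
Local Notation stE := (starE _ _ _ (proj1 hA)).
Local Notation starP := (proj1 hA).

Lemma eq_of_seminorms a b (K : Lam -> R) :
  (forall al e, 0 < e -> e <= 1 -> p al (a - b) <= K al * e) -> a = b.
Proof.
move=> h; apply: subr0_eq; case: hA => _ [_ [sep _]]; apply: sep => al.
apply/eqP; rewrite eq_le (q_ge0 $al) andbT.
by apply: (@le_eps_lin _ _ _ (K al)) => e e0 e1; rewrite add0r h.
Qed.

Lemma seminorm_directed al be :
  exists2 ga, (forall a, p al a <= p ga a) & (forall a, p be a <= p ga a).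
Proof.
by case: hA => _ [_ [_ [dir _]]]; have [ga h] := dir al be; exists ga => a; case: (h a).
Qed.

(* Completeness in the form in which it is used: [G al e] is a set of
   approximations of the desired element, of quality [e] for the seminorm
   [p al]. *)
Lemma approx_limit (G : Lam -> R -> A -> Prop) :
  (forall al e, 0 < e -> exists b, G al e b) ->
  (forall al be e e' b, (forall a, p al a <= p be a) -> e <= e' ->
     G be e b -> G al e' b) ->
  (forall al e, 0 < e -> exists2 d, 0 < d &
     forall b b', G al d b -> G al d b' -> p al (b - b') < e) ->
  exists x, forall al e, 0 < e -> exists2 b, G al e b & p al (b - x) < e.
Proof.
move=> Gne Gmono Gcauchy.
(* Without seminorms the conclusion is vacuous, while [F] below would be empty and not a filter. *)
have [[al0]|noLam] := pselect (inhabited Lam); last first.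
  by exists 0 => al; exfalso; apply: noLam; constructor.
pose F (P : A -> Prop) := exists al e, 0 < e /\ forall b, G al e b -> P b.
have Gmin al be d e b : (forall a, p al a <= p be a) -> G be (Num.min d e) b ->
    G al d b.
  by move=> h; apply: Gmono => //; rewrite ge_min lexx.
have Fproper : is_proper_filter F.
  split.
  - by exists al0, 1.
  - move=> P Q [al [d [d0 hP]]] [be [e [e0 hQ]]].
    have [ga h1 h2] := seminorm_directed al be.
    exists ga, (Num.min d e); split; first by rewrite lt_min d0.
    move=> b Gb; split; [apply: hP|apply: hQ].
      exact: Gmin h1 Gb.
    by move: Gb; rewrite minC; exact: Gmin h2.
  - by move=> P Q PQ [al [e [e0 hP]]]; exists al, e; split=> // b /hP /PQ.
  - by move=> [al [e [e0 hP]]]; have [b /hP] := Gne al e e0.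
have Fcauchy : filter_cauchy p F.
  move=> al e e0; have [d d0 hd] := Gcauchy al e e0.
  by exists (G al d) => //; exists al, d.
case: hA => _ [_ [_ [_ [_ [_ compl]]]]].
have [x hx] := compl F Fproper Fcauchy.
exists x => al e e0; have [be [d [d0 hd]]] := hx [:: al] e e0.
have [ga h1 h2] := seminorm_directed al be.
have m0 : 0 < Num.min d e by rewrite lt_min d0.
have [b Gb] := Gne ga _ m0; exists b.
  by move: Gb; rewrite minC; exact: Gmin h1.
apply: (hd b); first exact: Gmin h2 Gb.
by left.
Qed.

(** [pos_positive] and [positive_pos] identify this with the spectral condition. *)
Definition pos (a : A) := forall al, psd R A star (p al) a.

Lemma pos_star a : pos a -> star a = a.
Proof.
move=> pa; apply: (@eq_of_seminorms _ _ (fun=> 0)) => al e _ _.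
by rewrite (psd_star $al _ (pa al)) subrr (q0 $al) mul0r.
Qed.

Lemma posD a b : pos a -> pos b -> pos (a + b).
Proof. by move=> pa pb al; apply: (psdD $al). Qed.

Lemma posZ s a : 0 <= s -> pos a -> pos (s *:: a).
Proof. by move=> s0 pa al; apply: (psdZ $al). Qed.

Lemma pos_const s : 0 <= s -> pos (s *:: 1).
Proof. by move=> s0 al; apply: (psd_const $al). Qed.

Lemma pos_sq a : star a = a -> pos (a * a).
Proof. by move=> sa al; apply: (psd_sq $al). Qed.

Lemma pos_starM a : pos (star a * a).
Proof. by move=> al; apply: (psd_starM $al). Qed.

Lemma pos_conj a v : pos v -> pos (star a * v * a).
Proof. by move=> pv al; apply: (psd_conj $al). Qed.

Lemma inv_star m w : star m = m -> m * w = 1 -> w * m = 1 -> star w = w.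
Proof.
move=> sm mw wm; rewrite -[LHS]mulr1 -mw mulrA.
by have -> : star w * m = 1;
  rewrite ?mul1r // -{1}sm -(starM _ _ _ starP) mw (star1 _ _ _ starP).
Qed.

Lemma inv_comm (m w c : A) : m * w = 1 -> w * m = 1 -> c * m = m * c -> c * w = w * c.
Proof.
move=> mw wm cm; rewrite -[LHS]mul1r -wm -!mulrA [m * (c * w)]mulrA -cm -mulrA mw.
by rewrite mulr1.
Qed.

(** Approximate right inverses are Cauchy by [psd_lower]. Self-adjointness of r + a makes their
    limit x two-sided, and x = x^* (r + a) x makes it positive. *)
Lemma pos_resolvent a r : pos a -> 0 < r -> exists w,
  [/\ (r *:: 1 + a) * w = 1, w * (r *:: 1 + a) = 1, pos w,
      (forall al, r * p al w <= 1) & (forall al, p al (a * w) <= 1)].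
Proof.
move=> pa r0; set m := r *:: 1 + a.
have pm : pos m by apply: posD => //; apply: pos_const; exact: ltW.
have sm := pos_star _ pm.
have [x hx] : exists x, forall al e, 0 < e ->
    exists2 b, p al (m * b - 1) <= e & p al (b - x) < e.
  apply: (@approx_limit (fun al e b => p al (m * b - 1) <= e)).
  - by move=> al e e0; apply: (psd_right_inv_approx $al).
  - by move=> al be e e' b le ee' hb; apply: le_trans (le _) (le_trans hb ee').
  - move=> al e e0; exists (r * e / 4); first by rewrite divr_gt0 ?mulr_gt0.
    move=> b b' hb hb'.
    have h1 := psd_lower $al a r (b - b') (pa al) r0.
    have h2 := q_tri $al (m * b) 1 (m * b').
    rewrite -/m mulrBr in h1; rewrite [p al (1 - _)](qBC $al) in h2.
    have h3 : r * p al (b - b') <= r * (e / 2) by lra.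
    by rewrite ler_pM2l // in h3; lra.
have mx : m * x = 1.
  apply: (@eq_of_seminorms _ _ (fun al => p al m + 1)) => al e e0 _.
  have [b h1 h2] := hx al e e0.
  apply: le_trans (q_tri $al _ (m * b) _) _; rewrite -mulrBr.
  have h3 := qM $al m (x - b); rewrite (qBC $al) in h2.
  have : p al m * p al (x - b) <= p al m * e by rewrite ler_wpM2l ?(q_ge0 $al) // ltW.
  lra.
have xm' : star x * m = 1 by rewrite -{1}sm -(starM _ _ _ starP) mx (star1 _ _ _ starP).
have sx : star x = x by rewrite -[star x]mulr1 -mx mulrA xm' mul1r.
have xm : x * m = 1 by rewrite -{1}sx.
have px : pos x.
  by have := pos_conj x _ pm; rewrite sx xm mul1r.
exists x; split=> // al.
  by have [] := psd_resolvent_bounds $al a r x (pa al) r0 xm mx (px al).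
by have [] := psd_resolvent_bounds $al a r x (pa al) r0 xm mx (px al).
Qed.

(** For z = u + iv with v nonzero, the product of z - a and its adjoint is v^2 + (u - a)^2, which
    [pos_resolvent] inverts; for z = u < 0, it inverts -u + a. *)
Lemma pos_positive a : pos a -> positive star a.
Proof.
move=> pa; have sa := pos_star _ pa; split=> // z ninv.
case: z ninv => u v ninv.
have [v0|v0] := eqVneq v 0; last first.
  exfalso; apply: ninv.
  pose b := (u *:: 1 - a) * (u *:: 1 - a).
  have pb : pos b by apply: pos_sq; rewrite !stE sa.
  have v2 : 0 < v ^+ 2 by rewrite exprn_even_gt0.
  have [w [mw wm _ _ _]] := pos_resolvent b _ pb v2.
  set z := (u +i* v)%C; pose y := (u -i* v)%C *: 1 - a.
  have zy : (z + (u -i* v)%C) = u%:C%C + u%:C%C.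
    by apply/eqP; rewrite eq_complex /= !addr0 subrr !eqxx.
  have zz : z * (u -i* v)%C = (u ^+ 2 + v ^+ 2)%:C%C.
    by apply/eqP; rewrite eq_complex /=; apply/andP; split; apply/eqP; ring.
  have e1 : (z *: 1 - a) * y = (v ^+ 2) *:: 1 + b.
    have -> : (z *: 1 - a) * y = (z * (u -i* v)%C) *: 1 - (z + (u -i* v)%C) *: a + a * a.
      by rewrite /y; nc_alg.
    by rewrite zz zy /b; nc_alg.
  have e2 : y * (z *: 1 - a) = (v ^+ 2) *:: 1 + b.
    by rewrite -e1 /y; nc_alg.
  exists (y * w); split; first by rewrite mulrA e1.
  have -> : y * w = w * y.
    rewrite -[LHS]mul1r -{1}wm -e2 -!mulrA [(z *: 1 - a) * (y * w)]mulrA e1 mw.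
    by rewrite mulr1.
  by rewrite -mulrA e2.
rewrite v0 in ninv *; rewrite lecE /= eqxx /= leNgt; apply/negP => u0.
apply: ninv; have nu : 0 < - u by lra.
have [w [mw wm _ _ _]] := pos_resolvent a _ pa nu.
exists (- w); have e : (u +i* 0)%C *: 1 - a = - ((- u) *:: 1 + a).
  by rewrite [(u +i* 0)%C](_ : _ = u%:C%C) //; nc_alg.
by rewrite e !mulrNN.
Qed.

(** An inverse w of e = M - m would give e >= 1 / p al w, hence m <= M - c with c > 0, against p al
    m = M. Capping c at M keeps M - c nonnegative. *)
Lemma psd_norm_sub_not_unit (al : Lam) m M w :
  psd R A star (p al) m -> star m = m -> p al m = M ->
  0 < M -> star w = w -> (M *:: 1 - m) * w = 1 -> w * (M *:: 1 - m) = 1 -> False.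
Proof.
move=> pm sm eM M0 sw ew we; set e := M *:: 1 - m in ew we.
have pe : psd R A star (p al) e by apply: (psd_shift $al) => //; rewrite eM.
have pw : psd R A star (p al) w.
  by have := psd_conj $al w e pe; rewrite sw we mul1r.
have W0 : 0 < p al w.
  rewrite lt_def (q_ge0 $al) andbT; apply/eqP => W0.
  have h1 := qM $al e w; rewrite ew W0 mulr0 in h1.
  have := qM $al m 1; rewrite mulr1 eM; have := q_ge0 $al 1.
  by nra.
have We : psd R A star (p al) (p al w *:: e - 1).
  have -> : p al w *:: e - 1 = e * (p al w *:: 1 - w)
    by rewrite mulrBr ew -scalerAr mulr1.
  apply: (psdM $al) => //; first exact: (psd_shift $al).
  by have c : e * w = w * e; [rewrite ew we|comm_alg].
pose c := Num.min (p al w)^-1 M.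
have c0 : 0 < c by rewrite lt_min invr_gt0 W0.
have cM : c <= M by rewrite ge_min lexx orbT.
have cW : c <= (p al w)^-1 by rewrite ge_min lexx.
have h : psd R A star (p al) ((M - c) *:: 1 - m).
  have Wn := gt0_realC_neq0 _ _ W0.
  have -> : (M - c) *:: 1 - m
      = (p al w)^-1 *:: (p al w *:: e - 1) + ((p al w)^-1 - c) *:: 1.
    by rewrite /e rmorphB fmorphV /=; nc_alg_with ltac:(by field).
  apply: (psdD $al); last by apply: (psd_const $al); lra.
  by apply: (psdZ $al) => //; rewrite invr_ge0 ltW.
have := psd_q_le $al _ _ pm h.
rewrite (qZp $al) ?subr_ge0 // eM.
by have := q1_le $al; have := q_ge0 $al 1; nra.
Qed.

(** For t = p al a and m = t - a, p al m > t would put the negative number t - p al m outside the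
    spectrum, so m - p al m would be invertible, which [psd_norm_sub_not_unit] excludes. *)
Lemma positive_pos a : positive star a -> pos a.
Proof.
move=> [/esym sa hz] al; split=> //; exists (p al a).
set t := p al a; set m := t *:: 1 - a.
rewrite leNgt; apply/negP => tm.
have t0 : 0 <= t by apply: (q_ge0 $al).
have pm : psd R A star (p al) m by apply: (psd_shift $al).
have sm : star m = m by rewrite /m !stE sa.
have M0 : 0 < p al m by lra.
have : invertible ((t - p al m)%:C%C *: 1 - a).
  apply: contrapT => /hz; rewrite lecE /= => /andP[_].
  lra.
move=> [b [h1 h2]].
have e1 : p al m *:: 1 - m = - ((t - p al m)%:C%C *: 1 - a) by rewrite /m; nc_alg.
have h3 : (p al m *:: 1 - m) * (- b) = 1 by rewrite e1 mulrNN.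
have h4 : (- b) * (p al m *:: 1 - m) = 1 by rewrite e1 mulrNN.
apply: (psd_norm_sub_not_unit al m _ (- b) pm sm erefl M0 _ h3 h4).
apply: inv_star h3 h4.
by rewrite (starB _ _ _ starP) (starZ _ _ _ starP) (star1 _ _ _ starP) sm.
Qed.

(** * Square roots and absolute values *)

(** Approximate roots in the bicommutant of [a] commute, so [q_sub_sqr_le] shows that they are
    Cauchy: accuracy e^2 / 4 for the squares yields e for the roots. *)
Lemma pos_sqrt a : pos a -> exists k, [/\ pos k, k * k = a & bicommutes R A a k].
Proof.
move=> pa; have sa := pos_star _ pa.
have [x hx] : exists x, forall al e, 0 < e -> exists2 k,
    [/\ star k = k, bicommutes R A a k, psd R A star (p al) k & p al (k * k - a) <= e]
    & p al (k - x) < e.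
  apply: (@approx_limit (fun al e k => [/\ star k = k, bicommutes R A a k,
      psd R A star (p al) k & p al (k * k - a) <= e])).
  - by move=> al e e0; apply: (psd_sqrt $al).
  - move=> al be e e' k le ee' [sk ck [_ [t ht]] hk]; split=> //.
      by split=> //; exists t; apply: le_trans (le _) ht.
    by apply: le_trans (le _) (le_trans hk ee').
  - move=> al e e0; exists (e ^+ 2 / 4); first by rewrite divr_gt0 ?exprn_gt0.
    move=> k l [sk ck pk hk] [sl cl pl hl].
    have c : k * l = l * k by apply: cl; symmetry; apply: ck.
    have h1 := q_sub_sqr_le $al k l pk pl c.
    have h2 := q_tri $al (k * k) a (l * l).
    rewrite [p al (a - _)](qBC $al) in h2.
    rewrite ltNge; apply/negP => h3; have := q_ge0 $al (k - l); nra.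
have bc : bicommutes R A a x.
  move=> c ca; apply: (@eq_of_seminorms _ _ (fun al => 2 * p al c)) => al e e0 _.
  have [k [_ ck _ _] hk] := hx al e e0.
  have -> : c * x - x * c = (k - x) * c - c * (k - x).
    by have := ck c ca; move=> ckc; rewrite mulrBl mulrBr ckc; nc_alg.
  apply: le_trans (qB $al _ _) _.
  have := qM $al (k - x) c; have := qM $al c (k - x); have := q_ge0 $al c.
  nra.
have sx : star x = x.
  apply: (@eq_of_seminorms _ _ (fun=> 2)) => al e e0 _.
  have [k [sk _ _ _] hk] := hx al e e0.
  have := q_tri $al (star x) k x; rewrite -{1}sk -(starB _ _ _ starP) (q_star $al).
  by rewrite [p al (x - k)](qBC $al); lra.
exists x; split=> //.
  move=> al; apply: (@psd_closed _ _ _ _ starP (proj1 (proj2 hA) al) _ 1) => // e e0 _.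
  have [k [_ _ pk _] hk] := hx al e e0; exists k => //.
  by rewrite (qBC $al) mul1r ltW.
apply: (@eq_of_seminorms _ _ (fun al => 2 * p al x + 2)) => al e e0 e1.
have [k [_ _ _ hk] hkx] := hx al e e0.
have -> : x * x - a = (k * k - a) - (x * (k - x) + (k - x) * k) by nc_alg.
apply: le_trans (qB $al _ _) _.
have := qD $al (x * (k - x)) ((k - x) * k).
have := qM $al x (k - x); have := qM $al (k - x) k.
have := q_split $al k x; have := q_ge0 $al x; have := q_ge0 $al k.
have := q_ge0 $al (k - x).
nra.
Qed.

(** Here y = |i|, and m = y - i satisfies m^2 = 2 y m. With w = (e^2 + 2 y)^-1, the positive element
    w m^2 differs from m by e^2 w m, which is of order e because (w m)^2 = w (2 y w) m. *)
Lemma pos_abs i : star i = i -> exists y, [/\ pos y, y * y = i * i & pos (y - i)].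
Proof.
move=> si; have [y [py yy by_]] := pos_sqrt _ (pos_sq _ si).
exists y; split=> // al; have sy := pos_star _ py.
have c : i * y = y * i by apply: by_; rewrite mulrA.
set m := y - i; have sm : star m = m by rewrite /m !stE sy si.
have mm : m * m = 2 *:: (y * m).
  rewrite /m (_ : (y - i) * (y - i) = y * y - 2 *:: (y * i) + i * i); last by comm_alg.
  by rewrite -yy; nc_alg.
apply: (@psd_closed _ _ _ _ starP (proj1 (proj2 hA) al) _ (p al m + 1)) => // e e0 _.
have e2 : 0 < e ^+ 2 by rewrite exprn_gt0.
have p2y : pos (2 *:: y) by apply: posZ.
have [w [vw wv pw hw1 hw2]] := pos_resolvent _ _ p2y e2.
have sw := pos_star _ pw.
have cyw : y * w = w * y by apply: (inv_comm _ _ _ vw wv); nc_alg.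
have cmy : m * y = y * m by rewrite /m mulrBl mulrBr c.
have cmw : m * w = w * m.
  by apply: (inv_comm _ _ _ vw wv); comm_alg.
exists (w * (m * m)).
  by apply: (psdM $al) => //; [exact: pos_sq|comm_alg].
have em : m - w * (m * m) = (e ^+ 2) *:: (w * m).
  rewrite mm -{1}[m]mul1r -wv; comm_alg.
rewrite em; apply: ler_of_sqr.
  by rewrite mulr_ge0 ?addr_ge0 ?(q_ge0 $al) // ltW.
rewrite (qZp $al) ?sqr_ge0 // exprMn.
have -> : p al (w * m) ^+ 2 = p al (w * (((2 *:: y) * w) * m)).
  rewrite -(q_sqr $al) ?(starM _ _ _ starP) ?sw ?sm //.
  have -> : w * m * (w * m) = w * w * (m * m) by comm_alg.
  by rewrite mm; congr (p al _); comm_alg.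
have h1 := qM $al w ((2 *:: y) * w * m).
have h2 := qM $al ((2 *:: y) * w) m.
have h3 := hw1 al; have h4 := hw2 al.
have a1 := q_ge0 $al w; have a2 := q_ge0 $al m; have a3 := q_ge0 $al ((2 *:: y) * w).
have h5 : p al ((2 *:: y) * w * m) <= p al m by nra.
have h6 : e ^+ 2 * p al (w * ((2 *:: y) * w * m)) <= p al m.
  apply: (@le_trans _ _ (e ^+ 2 * (p al w * p al m))).
    by rewrite ler_wpM2l ?(ltW e2) //; apply: le_trans h1 _; rewrite ler_wpM2l.
  by rewrite mulrA -[leRHS]mul1r ler_wpM2r.
rewrite [leRHS]exprMn [leRHS]mulrC [(e ^+ 2) ^+ 2]expr2 -[leLHS]mulrA.
apply: ler_wpM2l; first exact: ltW.
by apply: le_trans h6 _; nra.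
Qed.

(** * Closed ideals *)

Lemma seminorms_bounded l : l = [::] \/
  exists ga, forall al, List.In al l -> forall a, p al a <= p ga a.
Proof.
elim: l => [|al l [->|[ga h]]]; [by left|right; exists al|right].
  by move=> be [->|[]].
have [de h1 h2] := seminorm_directed al ga.
by exists de => be [<-|/h hb] a; rewrite ?h1 // (le_trans (hb a)).
Qed.

(** Directedness replaces the finite lists of [tclosed] by one seminorm; the inhabitant of [S]
    serves the empty list. *)
Lemma closed_limit (S : A -> Prop) x : tclosed p S -> (exists y, S y) ->
  (forall al e, 0 < e -> exists2 y, S y & p al (y - x) < e) -> S x.
Proof.
move=> cS [y0 hy0] h; apply: cS => l e e0.
have [->|[ga hga]] := seminorms_bounded l; first by exists y0; split=> //.
have [y Sy hy] := h ga e e0; exists y; split=> // al hal.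
exact: le_lt_trans (hga al hal _) hy.
Qed.

(** With d = (e / 2)^2 and w = (d + k^2)^-1, the element k k^2 w of [S] differs from k by d k w,
    whose square d^2 w k^2 w has seminorm at most d. *)
Lemma ideal_sqrt (S : A -> Prop) k : closed_star_ideal star p S ->
  star k = k -> S (k * k) -> S k.
Proof.
move=> [S0 [_ [_ [SM [_ cS]]]]] sk Sk.
apply: closed_limit cS _ _; first by exists 0.
move=> al e e0; have e2 : 0 < (e / 2) ^+ 2 by rewrite exprn_gt0 // divr_gt0.
have [w [vw wv pw hw1 hw2]] := pos_resolvent _ _ (pos_sq _ sk) e2.
have sw := pos_star _ pw.
have ckw : k * w = w * k by apply: (inv_comm _ _ _ vw wv); nc_alg.
exists (k * (k * k * w)).
  by have [h _] := SM _ k (proj2 (SM _ w Sk)).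
have -> : k * (k * k * w) - k = - (((e / 2) ^+ 2) *:: (k * w)).
  rewrite [X in _ - X](_ : k = k * ((((e / 2) ^+ 2) *:: 1 + k * k) * w)).
    by nc_alg.
  by rewrite vw mulr1.
rewrite (qN $al) (qZp $al) ?(ltW e2) //.
suff h : (e / 2) ^+ 2 * p al (k * w) <= e / 2 by lra.
apply: ler_of_sqr; first by rewrite ltW // divr_gt0.
rewrite exprMn -(q_sqr $al); last by rewrite (starM _ _ _ starP) sk sw.
have -> : k * w * (k * w) = w * (k * k * w) by comm_alg.
have h1 := qM $al w (k * k * w).
have h3 := hw1 al; have h4 := hw2 al.
have a1 := q_ge0 $al w; have a2 := q_ge0 $al (k * k * w).
have h5 : p al (w * (k * k * w)) <= p al w.
  by apply: le_trans h1 _; rewrite -[leRHS]mulr1 ler_wpM2l.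
set d := (e / 2) ^+ 2 in e2 h3 *.
rewrite expr2 -mulrA -[leRHS]mulr1 ler_wpM2l ?(ltW e2) //.
by apply: le_trans h3; rewrite ler_wpM2l // ltW.
Qed.

(** * The decomposition *)

(* Given c^2 <= s^2 and r^2 <= s^2, the elements r (e + s)^-1 c, which should
   be thought of as r s^-1 c, form a Cauchy net with an explicit rate. *)
Lemma quotient_limit (H : R -> A) (c s r : A) :
  star c = c -> pos s -> star r = r ->
  pos (s * s - c * c) -> pos (s * s - r * r) ->
  (forall e, 0 < e -> [/\ (e *:: 1 + s) * H e = 1, H e * (e *:: 1 + s) = 1,
     pos (H e) & forall al, p al (s * H e) <= 1]) ->
  exists w, forall al e, 0 < e -> p al (w - r * H e * c) <= e.
Proof.
move=> sc ps sr hc hr hH; have ss := pos_star _ ps.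
have dist al e d : 0 < e -> 0 < d ->
    p al (r * H e * c - r * H d * c) <= `|d - e|.
  move=> e0 d0; have [e1 e2 pe ne] := hH e e0; have [d1 d2 pd nd] := hH d d0.
  have se := pos_star _ pe; have sd := pos_star _ pd.
  have csd : s * H d = H d * s by apply: (inv_comm _ _ _ d1 d2); nc_alg.
  have cse : s * H e = H e * s by apply: (inv_comm _ _ _ e1 e2); nc_alg.
  have ced : H e * H d = H d * H e.
    by apply: (inv_comm _ _ _ d1 d2);
      rewrite mulrDr mulrDl -scalerAr -scalerAl mulr1 mul1r cse.
  pose g := H e - H d.
  have sg : star g = g by rewrite /g !stE se sd.
  have eg : g = (d - e) *:: (H e * H d).
    rewrite (_ : (d - e) *:: (H e * H d)
      = H e * ((d *:: 1 + s) * H d) - H e * (e *:: 1 + s) * H d); last by nc_alg.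
    by rewrite d1 e2 mulr1 mul1r.
  have -> : r * H e * c - r * H d * c = r * g * c by rewrite /g; nc_alg.
  (* First r^2 <= s^2, then, after an adjoint, c^2 <= s^2 replaces r g c by s g s, that is (d - e)
     (s H d) (s H e) up to order, with both factors bounded by 1. *)
  have h1 : p al (r * g * c) <= p al (s * g * c).
    apply: ler_of_sqr; first exact: (q_ge0 $al).
    rewrite -!(qstar $al); apply: (psd_q_le $al); first exact: pos_starM.
    have -> : star (s * g * c) * (s * g * c) - star (r * g * c) * (r * g * c)
        = star (g * c) * (s * s - r * r) * (g * c).
      by rewrite !(starM _ _ _ starP) ss sr sg sc; nc_alg.
    exact: pos_conj.
  have h2 : p al (c * g * s) <= p al (s * g * s).
    apply: ler_of_sqr; first exact: (q_ge0 $al).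
    rewrite -!(qstar $al); apply: (psd_q_le $al); first exact: pos_starM.
    have -> : star (s * g * s) * (s * g * s) - star (c * g * s) * (c * g * s)
        = star (g * s) * (s * s - c * c) * (g * s).
      by rewrite !(starM _ _ _ starP) ss sg sc; nc_alg.
    exact: pos_conj.
  have h3 : p al (s * g * c) = p al (c * g * s).
    by rewrite -(q_star $al) !(starM _ _ _ starP) ss sg sc mulrA.
  apply: le_trans h1 _; rewrite h3; apply: le_trans h2 _.
  have -> : s * g * s = (d - e) *:: ((s * H e) * (s * H d)).
    by rewrite eg; comm_alg.
  rewrite (qZ $al) -[leRHS]mulr1 ler_wpM2l //.
  apply: le_trans (qM $al _ _) _.
  by rewrite -[leRHS]mulr1; apply: ler_pM; rewrite ?(q_ge0 $al).
(* Quality e means a parameter at most e, whatever the seminorm. *)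
have [w hw] : exists w, forall al e, 0 < e ->
    exists2 b, (exists d, [/\ 0 < d, d <= e & b = r * H d * c]) & p al (b - w) < e.
  apply: (@approx_limit (fun al e b => exists d, [/\ 0 < d, d <= e & b = r * H d * c])).
  - by move=> _ e e0; exists (r * H e * c), e.
  - by move=> _ _ e e' b _ ee' [d [d0 de ->]]; exists d; split=> //; apply: le_trans ee'.
  - move=> al e e0; exists (e / 2); first by rewrite divr_gt0.
    move=> _ _ [d [d0 de ->]] [d' [d0' de' ->]].
    by apply: le_lt_trans (dist al _ _ d0 d0') _; rewrite ltr_norml; lra.
exists w => al e e0; apply: (@le_eps_lin _ _ _ 2) => f f0 _.
have [b [d [d0 df eb]] hb] := hw al f f0.
have h1 := q_tri $al w b (r * H e * c).
rewrite [p al (w - b)](qBC $al) in h1; rewrite {2}eb in h1.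
have h2 := dist al _ _ d0 e0.
have h3 : `|e - d| <= e + f by rewrite ler_norml; lra.
lra.
Qed.

Lemma starM_approx w v e al : e <= 1 -> p al (w - v) <= e ->
  p al (star w * w - star v * v) <= (2 * p al w + 1) * e.
Proof.
move=> e1 h.
have -> : star w * w - star v * v = star w * (w - v) + star (w - v) * v.
  by rewrite !stE; nc_alg.
apply: le_trans (qD $al _ _) _.
have h1 := qM $al (star w) (w - v); have h2 := qM $al (star (w - v)) v.
rewrite !(q_star $al) in h1 h2.
have h3 := q_split $al v w; rewrite [p al (v - w)](qBC $al) in h3.
have a1 := q_ge0 $al w; have a3 := q_ge0 $al (w - v).
have h4 : p al (w - v) * p al v <= p al (w - v) * (p al w + 1).
  by rewrite ler_wpM2l //; lra.
have h5 : p al (w - v) * (2 * p al w + 1) <= e * (2 * p al w + 1).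
  by rewrite ler_wpM2r //; lra.
lra.
Qed.

Lemma limit_in_ideal (S : A -> Prop) (v : R -> A) w :
  closed_star_ideal star p S ->
  (forall e, 0 < e -> S (star (v e) * v e)) ->
  (forall al e, 0 < e -> p al (w - v e) <= e) -> S (star w * w).
Proof.
move=> [S0 [_ [_ [_ [_ cS]]]]] Sv hw.
apply: closed_limit cS _ _; first by exists 0.
move=> al e e0; have a1 := q_ge0 $al w.
have K0 : 0 < 2 * p al w + 1 by lra.
pose d := Num.min 1 (e / (2 * (2 * p al w + 1))).
have d0 : 0 < d by rewrite lt_min ltr01 divr_gt0 // mulr_gt0.
exists (star (v d) * v d); first exact: Sv.
rewrite (qBC $al); have d1 : d <= 1 by rewrite ge_min lexx.
apply: le_lt_trans (starM_approx _ _ _ al d1 (hw al d d0)) _.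
have : d <= e / (2 * (2 * p al w + 1)) by rewrite ge_min lexx orbT.
by rewrite ler_pdivlMr ?mulr_gt0 //; nra.
Qed.

Lemma pos_sum_decomposition (S T : A -> Prop) (i j : A) :
  closed_star_ideal star p S -> closed_star_ideal star p T -> S i -> T j ->
  pos (i + j) -> exists a b, [/\ S a, pos a, T b, pos b & i + j = a + b].
Proof.
(* i + j is self-adjoint, so i and j may be replaced by their real parts without changing the
   sum. *)
move=> hS hT; wlog [si sj] : i j / star i = i /\ star j = j => [wl Si Tj pij|].
  have half (U : A -> Prop) u : closed_star_ideal star p U -> U u ->
      U (2^-1 *:: (u + star u)) /\ star (2^-1 *:: (u + star u)) = 2^-1 *:: (u + star u).
    move=> [_ [UD [UZ [_ [Ustar _]]]]] Uu; split.
      by apply: UZ; apply: UD => //; apply: Ustar.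
    by rewrite !stE [star u + u]addrC.
  have e : i + j = 2^-1 *:: (i + star i) + 2^-1 *:: (j + star j).
    have := pos_star _ pij; rewrite (starD _ _ _ starP) => sij.
    have -> : 2^-1 *:: (i + star i) + 2^-1 *:: (j + star j)
        = 2^-1 *:: ((i + j) + (star i + star j)) by nc_alg.
    by rewrite sij fmorphV /=; nc_alg_with ltac:(by field).
  have [Si' si'] := half S i hS Si; have [Tj' sj'] := half T j hT Tj.
  by rewrite e; apply: wl => //; rewrite -e.
move=> Si Tj pij.
have SM U u v : closed_star_ideal star p U -> U u -> U (v * u) /\ U (u * v).
  by move=> [_ [_ [_ [UM _]]]] Uu; apply: UM.
have [y [py yy yi]] := pos_abs _ si; have [z [pz zz zj]] := pos_abs _ sj.
have Sy : S y.
  by apply: ideal_sqrt (pos_star _ py) _ => //; rewrite yy; case: (SM S i i hS Si).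
have Tz : T z.
  by apply: ideal_sqrt (pos_star _ pz) _ => //; rewrite zz; case: (SM T j j hT Tj).
have [c [pc cc _]] := pos_sqrt _ pij.
have [s [ps ss _]] := pos_sqrt _ (posD _ _ py pz).
have [r [pr rr _]] := pos_sqrt _ py; have [r' [pr' rr' _]] := pos_sqrt _ pz.
have sc := pos_star _ pc; have sr := pos_star _ pr; have sr' := pos_star _ pr'.
have s_s := pos_star _ ps.
(* For e <= 0 nothing is asked of [H e], and 0 is the witness given to [choice]. *)
have [H hH] : exists H : R -> A, forall e, 0 < e ->
    [/\ (e *:: 1 + s) * H e = 1, H e * (e *:: 1 + s) = 1, pos (H e) &
        forall al, p al (s * H e) <= 1].
  have : forall e, exists h, 0 < e ->
    [/\ (e *:: 1 + s) * h = 1, h * (e *:: 1 + s) = 1, pos h &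
        forall al, p al (s * h) <= 1].
    move=> e; have [e0|_] := ltrP 0 e; last by exists 0.
    by have [h [h1 h2 h3 _ h5]] := pos_resolvent s e ps e0; exists h.
  by move=> /choice [H hH]; exists H.
have hc : pos (s * s - c * c).
  by rewrite ss cc (_ : _ - _ = (y - i) + (z - j)); [exact: posD|nc_alg].
have [w hw] : exists w, forall al e, 0 < e -> p al (w - r * H e * c) <= e.
  apply: (quotient_limit H c s r) => //.
  by rewrite ss rr (_ : _ - _ = z) //; nc_alg.
have [w' hw'] : exists w, forall al e, 0 < e -> p al (w - r' * H e * c) <= e.
  apply: (quotient_limit H c s r') => //.
  by rewrite ss rr' (_ : _ - _ = y) //; nc_alg.
exists (star w * w), (star w' * w'); split; try exact: pos_starM.
- apply: (limit_in_ideal S (fun e => r * H e * c)) => // e e0.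
  rewrite (_ : star _ * _ = star (H e * c) * y * (H e * c)).
    by apply: (proj2 (SM _ _ _ _ _)) => //; apply: (proj1 (SM _ _ _ _ _)).
  by rewrite -rr !(starM _ _ _ starP) sr; nc_alg.
- apply: (limit_in_ideal T (fun e => r' * H e * c)) => // e e0.
  rewrite (_ : star _ * _ = star (H e * c) * z * (H e * c)).
    by apply: (proj2 (SM _ _ _ _ _)) => //; apply: (proj1 (SM _ _ _ _ _)).
  by rewrite -rr' !(starM _ _ _ starP) sr'; nc_alg.
apply: (@eq_of_seminorms _ _ (fun al =>
  2 * p al c + (2 * p al w + 1) + (2 * p al w' + 1))) => al e e0 e1.
have [he1 he2 ph nh] := hH e e0; have sh := pos_star _ ph.
have csh : s * H e = H e * s by apply: (inv_comm _ _ _ he1 he2); nc_alg.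
set v := r * H e * c; set v' := r' * H e * c.
(* As r^2 + r'^2 = s^2, the two squares add up to c (H s)^2 c, and 1 - (H s)^2 factors as e H (1 + H
   s); the remainder is thus of order e. *)
have rest : i + j - (star v * v + star v' * v')
    = (e *:: (c * H e)) * ((1 + H e * s) * c).
  have -> : star v * v + star v' * v' = c * (H e * s * (s * H e)) * c.
    have -> : H e * s * (s * H e) = H e * (s * s) * H e by nc_alg.
    by rewrite /v /v' !(starM _ _ _ starP) sc sh sr sr' ss -rr -rr'; nc_alg.
  have eh : e *:: H e = 1 - H e * s by rewrite -[in RHS]he2; nc_alg.
  by rewrite scalerAr eh csh -cc; nc_alg.
have -> : i + j - (star w * w + star w' * w')
    = i + j - (star v * v + star v' * v')
      - (star w * w - star v * v) - (star w' * w' - star v' * v') by nc_alg.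
have h1 := starM_approx _ _ _ al e1 (hw al e e0).
have h2 := starM_approx _ _ _ al e1 (hw' al e e0).
have h3 : p al (c * H e) <= 1.
  apply: ler_of_sqr; first exact: ler01.
  rewrite expr1n -(qstar $al); apply: (@le_trans _ _ (p al (star (s * H e) * (s * H e)))).
    apply: (psd_q_le $al); first exact: pos_starM.
    have -> : star (s * H e) * (s * H e) - star (c * H e) * (c * H e)
        = star (H e) * (s * s - c * c) * H e.
      by rewrite !(starM _ _ _ starP) s_s sc; nc_alg.
    exact: pos_conj.
  by rewrite (qstar $al) expr_le1 // (q_ge0 $al).
have h4 : p al ((1 + H e * s) * c) <= 2 * p al c.
  apply: le_trans (qM $al _ _) _; rewrite ler_wpM2r ?(q_ge0 $al) //.
  apply: le_trans (qD $al _ _) _; rewrite -csh.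
  by have := nh al; have := q1_le $al; lra.
have h5 : p al (i + j - (star v * v + star v' * v')) <= 2 * p al c * e.
  rewrite rest; apply: le_trans (qM $al _ _) _; rewrite (qZp $al) ?(ltW e0) //.
  rewrite mulrC; apply: ler_pM => //; rewrite ?mulr_ge0 ?(q_ge0 $al) ?(ltW e0) //.
  by rewrite -[leRHS]mulr1 ler_wpM2l // ltW.
apply: le_trans (qB $al _ _) _.
by have := qB $al (i + j - (star v * v + star v' * v')) (star w * w - star v * v); lra.
Qed.

End LocallyCstarAlgebra.

Theorem theorem3 (R : realType) (A : algType R[i]) (star : A -> A)
    (Lam : Type) (p : Lam -> A -> R)
    (hA : locally_Cstar_algebra star p)
    (I J : A -> Prop)
    (hI : closed_star_ideal star p I) (hJ : closed_star_ideal star p J) :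
  forall x : A,
    ((exists i j, I i /\ J j /\ x = i + j) /\ positive star x) <->
    (exists a b, (I a /\ positive star a) /\ (J b /\ positive star b) /\ x = a + b).
Proof.
move=> x; split.
  move=> [[i [j [Ii [Jj ->]]]] /(positive_pos _ _ _ _ _ hA) pij].
  have [a [b [Ia pa Jb pb ->]]] :=
    pos_sum_decomposition _ _ _ _ _ hA _ _ _ _ hI hJ Ii Jj pij.
  exists a, b; split; first by split=> //; apply: (pos_positive _ _ _ _ _ hA).
  by split=> //; split=> //; apply: (pos_positive _ _ _ _ _ hA).
move=> [a [b [[Ia pa] [[Jb pb] ->]]]]; split; first by exists a, b.
apply: (pos_positive _ _ _ _ _ hA); apply: (posD _ _ _ _ _ hA).
  exact: (positive_pos _ _ _ _ _ hA).
exact: (positive_pos _ _ _ _ _ hA).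
Qed.
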